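(* Let $0<q<1$ and $t>0$, and let $\mu_t=\sum_{k\in\mathbb Z}m_t(k)\,\delta_{tq^k}$, where $m_t(k)=t^kq^{\binom{k+1}{2}}m_t(0)$ and $m_t(0)>0$. The Stieltjes--Wigert polynomials $S_n(x;q)$, $n\in\mathbb Z_+$, are orthogonal in $L^2(\mu_t)$, and so are the functions $M_r^{(t)}(x;q)$, $r\in\mathbb Z$; explicitly, for all $n,m\in\mathbb Z_+$ and $r,s\in\mathbb Z$, $$\frac{1}{(-tq,-1/t,q;q)_\infty}\sum_{k=-\infty}^\infty t^kq^{\binom{k+1}{2}}S_n(tq^k;q)S_m(tq^k;q)=\frac{\delta_{m,n}}{q^n(q;q)_n}$$ and $$\frac1{(-t;q)_\infty}\sum_{k=-\infty}^\infty t^kq^{\binom{k+1}{2}}M_r^{(t)}(tq^k;q)M_s^{(t)}(tq^k;q)=\frac{(-q/t;q)_r}{q^r}\,\delta_{r,s}.$$ Moreover, $S_n(x;q)$ and $M_r^{(t)}(x;q)$ are mutually orthogonal in $L^2(\mu_t)$, that is, $$\sum_{k=-\infty}^\infty t^kq^{\binom{k+1}{2}}S_n(tq^k;q)M_r^{(t)}(tq^k;q)=0\quad\text{for all } n\in\mathbb Z_+,\ r\in\mathbb Z,$$ and $\{S_n(x;q)\}_{n\in\mathbb Z_+}\cup\{M_r^{(t)}(x;q)\}_{r\in\mathbb Z}$ forms an orthogonal basis of $L^2(\mu_t)$.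
   Context: Notation: $\mathbb Z_+=\{0,1,2,\dots\}$; $(a;q)_\infty=\prod_{k=0}^\infty(1-aq^k)$, $(a_1,\dots,a_m;q)_\infty=\prod_i(a_i;q)_\infty$, and $(a;q)_n=(a;q)_\infty/(aq^n;q)_\infty$ for $n\in\mathbb Z$ (so $(a;q)_n=\prod_{k=0}^{n-1}(1-aq^k)$ for $n\ge0$). $\delta_x$ is the unit mass at $x$ and $\delta_{m,n}$ the Kronecker delta. For $z\in\mathbb C\setminus\{0\}$ and $x\in\mathbb C$, $$\phi_z(x)={}_1\varphi_1(1/z;0;q,-xzq)=\sum_{n=0}^\infty\frac{(1/z;q)_n}{(q;q)_n}z^nq^{\binom{n+1}{2}}x^n.$$ The Stieltjes--Wigert polynomials are $$S_n(x;q)=\frac1{(q;q)_n}\sum_{k=0}^n\frac{(q;q)_n}{(q;q)_k(q;q)_{n-k}}(-1)^kq^{k^2}x^k=\frac1{(q;q)_n}\phi_{q^n}(x),$$ and $$M_r^{(t)}(x;q)=\frac1{(q;q)_\infty}\phi_{-q^r/t}(x),\qquad r\in\mathbb Z.$$ (These are related to Jackson's second $q$-Bessel function $J^{(2)}_\nu(z;q)=\frac{(z/2)^\nu}{(q;q)_\infty}{}_1\varphi_1(-z^2/4;0;q,q^{\nu+1})$ by $t^{(k+r)/2}M_r^{(t)}(tq^k;q)=q^{r(r+k)/2}J^{(2)}_{k+r}(2\sqrt t\,q^{-r/2};q)$.) *)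

(* Defs.v *)
From HB Require Import structures.
From mathcomp Require Import all_boot all_order all_algebra.
From mathcomp Require Import all_classical all_reals all_analysis.
From mathcomp Require Export complex.

Set Implicit Arguments.
Unset Strict Implicit.
Unset Printing Implicit Defensive.

Import Order.TTheory GRing.Theory Num.Theory.
Import numFieldNormedType.Exports.

Local Open Scope classical_set_scope.
Local Open Scope ring_scope.
Local Open Scope complex_scope.

(* The formulas below are over an arbitrary numFieldType K, so as to cover
   complex arguments; only K = R is needed for the values at t q^k. *)

Definition qpoch (K : numFieldType) (a q : K) (n : nat) : K :=
  \prod_(k < n) (1 - a * q ^+ k).

Definition qpoch_inf (K : numFieldType) (a q : K) : K :=
  limn (fun n => qpoch a q n).

(* (a; q)_n for n in Z.  The denominator vanishes when a q^n = q^-j, j in Z_+;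
   this happens for the coefficients of phi at z = q^n, which therefore use the
   product qpoch. *)
Definition qpochz (K : numFieldType) (a q : K) (n : int) : K :=
  qpoch_inf a q / qpoch_inf (a * q ^ n) q.

Definition phi (K : numFieldType) (q z x : K) : K :=
  limn (series (fun n : nat =>
    qpoch z^-1 q n / qpoch q q n * z ^+ n * q ^+ 'C(n.+1, 2) * x ^+ n)).

Definition SW (K : numFieldType) (q : K) (n : nat) (x : K) : K :=
  (qpoch q q n)^-1 *
  \sum_(k < n.+1) qpoch q q n / (qpoch q q k * qpoch q q (n - k)) *
                  (-1) ^+ k * q ^+ (k ^ 2) * x ^+ k.

Definition Mfun (K : numFieldType) (q t : K) (r : int) (x : K) : K :=
  (qpoch_inf q q)^-1 * phi q (- (q ^ r / t)) x.

(* binom(k+1, 2) = k (k + 1) / 2 for k in Z; the division is exact. *)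
Definition binz (k : int) : int := ((k * (k + 1)) %/ 2)%Z.

(* Negz n is -(n+1). *)
Definition zsummable (R : realType) (f : int -> R) : Prop :=
  summable [set: int] (EFin \o f).

Definition zsum (R : realType) (f : int -> R) : R :=
  limn (series (fun n : nat => f (Posz n))) +
  limn (series (fun n : nat => f (Negz n))).

Section AtomicMeasure.
Context d (T : measurableType d) (R : realType).
Variables (m : int -> {nonneg R}) (x : int -> T).

Let atom (k : int) : {measure set T -> \bar R} := mscale (m k) \d_(x k).

Definition atomic_measure : {measure set T -> \bar R} :=
  measure_add (mseries (fun n : nat => atom (Posz n)) 0)
              (mseries (fun n : nat => atom (Negz n)) 0).

Lemma atomic_measureE (A : set T) :
  atomic_measure A = (\esum_(k in [set: int]) ((m k)%:num%:E * \d_(x k) A))%E.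
Proof.
set a := fun k : int => ((m k)%:num%:E * \d_(x k) A)%E.
have a0 k : (0 <= a k)%E by apply: mule_ge0; rewrite ?lee_fin.
rewrite [LHS]measure_addE /= /mseries.
rewrite (esumID (range Posz)) ?setTI; last by move=> k _; exact: a0.
have -> : ~` range Posz = range Negz.
  apply/seteqP; split => [[n|n] /= h|_ [n _ <-]] /=.
  - by case: h; exists n.
  - by exists n.
  - by case=> k.
rewrite !esum_image//; first by rewrite !nneseries_esumT.
- by move=> n n' _ _ [].
- by move=> n n' _ _ [].
Qed.

End AtomicMeasure.

Section ComplexL2.
Context d (T : measurableType d) (R : realType).
Variable mu : {measure set T -> \bar R}.
Implicit Types f g : T -> R[i].

Definition cintegral f : R[i] :=
  (\int[mu]_x complex.Re (f x))%R +i* (\int[mu]_x complex.Im (f x))%R.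

Definition L2 f : Prop :=
  (fun x => complex.Re (f x)) \in Lfun mu 2%:E /\
  (fun x => complex.Im (f x)) \in Lfun mu 2%:E.

Definition dotL2 f g : R[i] := cintegral (fun x => f x * (g x)^*).

Definition normL2 f : R := Num.sqrt (complex.Re (dotL2 f f)).

Definition orthogonal_family (I : Type) (e : I -> T -> R[i]) : Prop :=
  (forall i, L2 (e i)) /\ (forall i j, i <> j -> dotL2 (e i) (e j) = 0).

Definition orthogonal_basis (I : Type) (e : I -> T -> R[i]) : Prop :=
  [/\ orthogonal_family e,
      forall i, normL2 (e i) <> 0 &
      forall f, L2 f -> forall eps : R, 0 < eps ->
        exists (s : seq I) (c : I -> R[i]),
          normL2 (fun x => f x - \sum_(i <- s) c i * e i x) < eps].

End ComplexL2.

(* Main.v *)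
Require Import Defs.
From HB Require Import structures.
From mathcomp Require Import all_boot all_order all_algebra.
From mathcomp Require Import all_classical all_reals all_analysis.
From mathcomp Require Import measurable_realfun ring lra zify.

Set Implicit Arguments.
Unset Strict Implicit.
Unset Printing Implicit Defensive.

Import Order.TTheory GRing.Theory Num.Theory.
Import numFieldNormedType.Exports.

Local Open Scope classical_set_scope.
Local Open Scope ring_scope.
Local Open Scope complex_scope.

(** Put [x k = t q^k] and let [w k] be the weight at [x k], so that
    [w (k + 1) = x (k + 1) * w k].  For every [z] the sequence
    [f k = phi_z (x k)] solves a second-order difference equation [eigen z f],
    an eigenvalue problem that is symmetric for the weight [w], and
    [phi_z] and [phi_(q z)] are connected by a first-order relation [ladder].
    The functions of the theorem are, up to constants, [phi_z] for [z] in the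
    set made of the [q^n], [n >= 0], and the [- q^r / t], [r] an integer.

    Orthogonality.  Two eigenfunctions with distinct eigenvalues are orthogonal
    as soon as the Wronskian vanishes at both ends ([eigen_orthogonal]).  The
    weight decays like [q^(k^2/2)], so it suffices that the eigenfunctions grow
    at most exponentially in [k].  This is clear for polynomials; for
    [z = - q^r / t] it follows from the expansion of Jackson's second q-Bessel
    function, which is identified with [phi_z] by uniqueness of the solution
    with a given limit as [k] tends to infinity ([eigen_unique], [fM_J2]).

    Norms.  The ladder relation gives
    [q * |phi_(q z)|^2 = (1 - q z) * |phi_z|^2] ([ladder_norm]), so one norm in
    each family is enough.  For [z = 1] it is the total mass, evaluated by
    Jacobi's triple product ([triple_product]).  For [z = - q^r / t] it is read
    off from the limit [r] to minus infinity, in which the eigenfunction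
    concentrates at the single node [x (- r)] ([fM_norm_cvg]).

    Completeness.  Let [A k l] be the sum of [phi_z (x k) phi_z (x l)] divided
    by the squared norm of [phi_z], over all [z] in the set above; by Bessel's
    inequality it converges.  As a function of [z], [phi_z (x k)] solves a
    three-term recurrence with eigenvalue [x k].  Summation by parts in [z]
    leaves boundary terms at [z] to [+0], [z] to [-0] and [z] to minus infinity.
    The last one vanishes and the first two cancel, by the values of the norms,
    hence [A k l = 0] for [k != l] ([span_kernel_offdiag]).  The ladder relation
    then shows that [w k * A k k] does not depend on [k].  It is at most [1] by
    Bessel, and at least [1] because of the concentrating eigenfunctions
    ([span_kernel_diag]).  So Parseval's identity holds for every point mass,
    which makes all finitely supported functions, and then all of L^2, limits of
    linear combinations ([finite_approximation]). *)

(** * Absolutely convergent sums over the naturals and the integers *)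

Section Sums.
Context {R : realType}.
Implicit Types (u v : nat -> R) (f g : int -> R).

Definition nabs u := exists B : R, forall N, \sum_(n < N) `|u n| <= B.

(** Pairing the terms [n] and [- n - 1] makes this the sum over [- N <= k < N],
    a window on which differences telescope. *)
Definition zwin f (N : nat) : R := \sum_(n < N) (f (Posz n) + f (Negz n)).

Definition zabs f := exists B : R, forall N, zwin (fun k => `|f k|) N <= B.

Lemma nabs_cvg_norm u : nabs u -> cvgn [normed series u].
Proof.
move=> [B uB]; apply: nondecreasing_is_cvgn.
  apply/nondecreasing_seqP => n; rewrite /= seriesSr lerDl; exact: normr_ge0.
by exists B => _ [N _ <-]; rewrite /= /series /= big_mkord.
Qed.

Lemma nabs_cvg u : nabs u -> cvgn (series u).
Proof. by move=> /nabs_cvg_norm/normed_cvg. Qed.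

Lemma nabs_cvg0 u : nabs u -> u @ \oo --> (0 : R).
Proof. by move=> /nabs_cvg/cvg_series_cvg_0. Qed.

Lemma le_nabs u v : nabs v -> (forall n, `|u n| <= `|v n|) -> nabs u.
Proof.
move=> [B vB] uv; exists B => N; apply: le_trans (vB N).
by apply: ler_sum => i _; exact: uv.
Qed.

Lemma nabs_geometric (C rho : R) : 0 <= rho < 1 -> nabs (fun n => C * rho ^+ n).
Proof.
move=> /andP[r0 r1]; exists (`|C| / (1 - rho)) => N.
have -> : \sum_(n < N) `|C * rho ^+ n| = series (geometric `|C| rho) N.
  rewrite /series /= big_mkord; apply: eq_bigr => i _.
  by rewrite normrM (ger0_norm (exprn_ge0 _ r0)).
rewrite geometric_seriesE ?lt_eqF//=.
rewrite ler_wpM2r ?invr_ge0 ?subr_ge0 ?(ltW r1)//.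
by rewrite ler_piMr// lerBlDr lerDl exprn_ge0.
Qed.

Lemma zabs_nabs f :
  zabs f <-> nabs (fun n => f (Posz n)) /\ nabs (fun n => f (Negz n)).
Proof.
split=> [[B fB]|[[B fB] [C fC]]].
  split; exists B => N; apply: le_trans (fB N); apply: ler_sum => i _.
    by rewrite lerDl.
  by rewrite lerDr.
exists (B + C) => N; rewrite /zwin big_split; exact: lerD (fB N) (fC N).
Qed.

Lemma zabs_cvg f : zabs f -> zwin f @ \oo --> zsum f.
Proof.
move=> /zabs_nabs[/nabs_cvg fP /nabs_cvg fN].
have -> : zwin f = series (fun n => f (Posz n)) \+ series (fun n => f (Negz n)).
  by apply/funext => N; rewrite /zwin /series /= !big_mkord big_split.
exact: cvgD.
Qed.

Lemma zsumP f l : zabs f -> zwin f @ \oo --> l -> zsum f = l.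
Proof. by move=> /zabs_cvg fz fl; apply: (cvg_unique _ fz fl). Qed.

Lemma eq_zwin f g : f =1 g -> zwin f =1 zwin g.
Proof. by move=> fg N; apply: eq_bigr => i _; rewrite !fg. Qed.

Lemma eq_zsum f g : f =1 g -> zsum f = zsum g.
Proof. by move=> /funext ->. Qed.

Lemma eq_zabs f g : f =1 g -> zabs f -> zabs g.
Proof. by move=> /funext ->. Qed.

Lemma le_zwin f g N : (forall k, f k <= g k) -> zwin f N <= zwin g N.
Proof. by move=> fg; apply: ler_sum => i _; exact: lerD. Qed.

Lemma le_zabs f g : zabs g -> (forall k, `|f k| <= `|g k|) -> zabs f.
Proof.
by move=> [B gB] fg; exists B => N; apply: le_trans (gB N); exact: le_zwin.
Qed.

Lemma zwinD f g N : zwin (fun k => f k + g k) N = zwin f N + zwin g N.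
Proof. by rewrite -big_split; apply: eq_bigr => i _ /=; rewrite addrACA. Qed.

Lemma zwinZ c f N : zwin (fun k => c * f k) N = c * zwin f N.
Proof. by rewrite mulr_sumr; apply: eq_bigr => i _ /=; rewrite mulrDr. Qed.

Lemma zabsD f g : zabs f -> zabs g -> zabs (fun k => f k + g k).
Proof.
move=> [B fB] [C gC]; exists (B + C) => N.
apply: le_trans (lerD (fB N) (gC N)); rewrite -zwinD.
by apply: le_zwin => k; exact: ler_normD.
Qed.

Lemma zabsZ c f : zabs f -> zabs (fun k => c * f k).
Proof.
move=> [B fB]; exists (`|c| * B) => N.
rewrite (eq_zwin (fun k => normrM c (f k))) zwinZ.
exact: ler_wpM2l.
Qed.

Lemma zsumD f g : zabs f -> zabs g ->
  zsum (fun k => f k + g k) = zsum f + zsum g.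
Proof.
move=> fz gz; apply: zsumP; first exact: zabsD.
by rewrite (funext (zwinD f g)); apply: cvgD; exact: zabs_cvg.
Qed.

Lemma zsumZ c f : zabs f -> zsum (fun k => c * f k) = c * zsum f.
Proof.
move=> fz; apply: zsumP; first exact: zabsZ.
by rewrite (funext (zwinZ c f)); apply: cvgMr; exact: zabs_cvg.
Qed.

Lemma zabsB f g : zabs f -> zabs g -> zabs (fun k => f k - g k).
Proof.
move=> fz gz; apply: (@eq_zabs (fun k => f k + (-1) * g k)).
  by move=> k; rewrite mulN1r.
by apply: zabsD => //; exact: zabsZ.
Qed.

Lemma zsumB f g : zabs f -> zabs g ->
  zsum (fun k => f k - g k) = zsum f - zsum g.
Proof.
move=> fz gz; rewrite -mulN1r -zsumZ// -zsumD//; last exact: zabsZ.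
by apply: eq_zsum => k; rewrite mulN1r.
Qed.

Lemma zabs0 : zabs (fun=> 0 : R).
Proof. by exists 0 => N; rewrite /zwin big1// => i _; rewrite normr0 addr0. Qed.

Lemma zsum0 : zsum (fun=> 0 : R) = 0.
Proof.
apply: zsumP; first exact: zabs0.
rewrite (_ : zwin _ = fun=> 0); first exact: cvg_cst.
by apply/funext => N; rewrite /zwin big1// => i _; rewrite addr0.
Qed.

Lemma zwin_le_zsum f N : zabs f -> (forall k, 0 <= f k) -> zwin f N <= zsum f.
Proof.
move=> fz f0; have fc := zabs_cvg fz.
rewrite -(cvg_lim _ fc)//; apply: nondecreasing_cvgn_le; last first.
  by apply/cvg_ex; exists (zsum f).
apply/nondecreasing_seqP => n.
by rewrite /zwin big_ord_recr /= lerDl addr_ge0.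
Qed.

Lemma zsum_ge0 f : zabs f -> (forall k, 0 <= f k) -> 0 <= zsum f.
Proof. by move=> fz f0; apply: le_trans (zwin_le_zsum 0 fz f0); rewrite /zwin big_ord0. Qed.

Lemma ler_zsum f g : zabs f -> zabs g -> (forall k, f k <= g k) ->
  zsum f <= zsum g.
Proof.
move=> fz gz fg; rewrite -subr_ge0 -zsumB//; apply: zsum_ge0; first exact: zabsB.
by move=> k; rewrite subr_ge0.
Qed.

Lemma le_zwin_term f N : (forall k, 0 <= f k) -> forall k, (`|k| < N)%N -> f k <= zwin f N.
Proof.
move=> f0 [k|k] /= kN; rewrite /zwin.
  by rewrite (bigD1 (Ordinal kN))//= -addrA lerDl addr_ge0// sumr_ge0// => i _; exact: addr_ge0.
have {}kN := ltnW kN.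
by rewrite (bigD1 (Ordinal kN))//= addrAC lerDr addr_ge0// sumr_ge0// => i _; exact: addr_ge0.
Qed.

Lemma le_zsum_term f k : zabs f -> (forall k, 0 <= f k) -> f k <= zsum f.
Proof.
move=> fz f0; apply: le_trans (zwin_le_zsum (`|k|%N).+1 fz f0).
exact: le_zwin_term.
Qed.

Lemma zabs_Posz_cvg0 f : zabs f -> (fun n => f (Posz n)) @ \oo --> (0 : R).
Proof. by move=> /zabs_nabs[/nabs_cvg0]. Qed.

Lemma zabs_opp_cvg0 f : zabs f -> (fun n => f (- Posz n)) @ \oo --> (0 : R).
Proof.
move=> /zabs_nabs[_ /nabs_cvg0 fn].
by rewrite -cvg_shiftS /=; under eq_fun do rewrite -NegzE.
Qed.

Lemma zwin_telescope f N :
  zwin (fun k => f (k + 1) - f k) N = f (Posz N) - f (- Posz N).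
Proof.
elim: N => [|N IHN]; first by rewrite /zwin big_ord0 oppr0 subrr.
rewrite [LHS]big_ord_recr /= -/(zwin (fun k => f (k + 1) - f k) N) IHN NegzE.
rewrite (_ : - N.+1%:Z + 1 = - N%:Z); last by lia.
rewrite (_ : N%:Z + 1 = N.+1); last by lia.
ring.
Qed.

Lemma zwin_shift f N :
  zwin (fun k => f (k + 1)) N = zwin f N + f (Posz N) - f (- Posz N).
Proof.
rewrite -addrA -zwin_telescope -zwinD; apply: eq_zwin => k.
by rewrite [RHS]addrC subrK.
Qed.

Lemma zabs_shift f : zabs f -> zabs (fun k => f (k + 1)).
Proof.
move=> [B fB]; exists B => N.
rewrite (zwin_shift (fun k => `|f k|)).
apply: le_trans (fB N.+1); rewrite [leRHS]big_ord_recr /= -addrA lerD2l lerD2l.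
by apply: (@le_trans _ _ 0); rewrite ?oppr_le0.
Qed.

Lemma zsum_shift f : zabs f -> zsum (fun k => f (k + 1)) = zsum f.
Proof.
move=> fz; apply: zsumP; first exact: zabs_shift.
rewrite (_ : zwin _ = fun N => zwin f N + f (Posz N) - f (- Posz N)); last first.
  by apply/funext => N; exact: zwin_shift.
rewrite -[X in _ --> X]subr0 -[X in _ --> X - _]addr0.
apply: cvgB; last exact: zabs_opp_cvg0.
by apply: cvgD; [exact: zabs_cvg|exact: zabs_Posz_cvg0].
Qed.

Lemma zabs_shiftN f : zabs f -> zabs (fun k => f (k - 1)).
Proof.
move=> [B fB]; exists B => N; apply: le_trans (fB N.+1).
have := zwin_shift (fun k => `|f (k - 1)|) N.
rewrite (eq_zwin (g := fun k => `|f k|)) => [|k]; last by rewrite addrK.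
rewrite [leRHS]big_ord_recr /= -/(zwin (fun k => `|f k|) N) NegzE => ->.
rewrite (_ : - N.+1%:Z = - N%:Z - 1); last by lia.
have := normr_ge0 (f N); have := normr_ge0 (f (N%:Z - 1)); lra.
Qed.

Lemma zsum_shiftN f : zabs f -> zsum (fun k => f (k - 1)) = zsum f.
Proof.
move=> fz; rewrite -(zsum_shift (zabs_shiftN fz)).
by apply: eq_zsum => k; rewrite addrK.
Qed.

Lemma zsum_shift_nat f (n : nat) : zabs f ->
  zabs (fun k => f (k + n%:Z)) /\ zsum (fun k => f (k + n%:Z)) = zsum f.
Proof.
move=> fz; elim: n => [|n [IH1 IH2]].
  by split; [apply: eq_zabs fz => k|apply: eq_zsum => k]; rewrite addr0.
split; first by apply: eq_zabs (zabs_shift IH1) => k; congr f; lia.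
by rewrite -IH2 -(zsum_shift IH1); apply: eq_zsum => k; congr f; lia.
Qed.

Lemma zsum_telescope f : zabs f -> zsum (fun k => f (k + 1) - f k) = 0.
Proof. by move=> fz; rewrite zsumB ?zsum_shift ?subrr//; exact: zabs_shift. Qed.

Lemma zwin_single f k0 N : (forall k, k != k0 -> f k = 0) -> (`|k0| < N)%N ->
  zwin f N = f k0.
Proof.
move=> f0; case: k0 f0 => n f0 nN; rewrite /zwin.
  rewrite (bigD1 (Ordinal nN))//= big1 ?addr0 => [|i /eqP ni].
    by rewrite [f (Negz n)]f0 ?addr0.
  rewrite !f0 ?addr0//; apply/eqP => -[/= ni']; apply: ni; exact: val_inj.
have {}nN := ltnW nN.
rewrite (bigD1 (Ordinal nN))//= big1 ?addr0 => [|i /eqP ni].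
  by rewrite [f (Posz n)]f0 ?add0r.
rewrite !f0 ?addr0//; apply/eqP => -[/= ni']; apply: ni; exact: val_inj.
Qed.

Lemma zabs_single f k0 : (forall k, k != k0 -> f k = 0) -> zabs f.
Proof.
move=> f0; exists `|f k0| => N.
apply: le_trans (_ : zwin (fun k => `|f k|) (maxn N `|k0|.+1) <= _).
  rewrite -(subnKC (leq_maxl N `|k0|.+1)) /zwin big_split_ord /= lerDl.
  by apply: sumr_ge0 => i _; exact: addr_ge0.
rewrite (@zwin_single (fun k => `|f k|) k0)// ?leq_max ?leqnn ?orbT//.
by move=> k /f0 ->; rewrite normr0.
Qed.

Lemma zsum_single f k0 : (forall k, k != k0 -> f k = 0) -> zsum f = f k0.
Proof.
move=> f0; apply: zsumP; first exact: (zabs_single f0).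
rewrite -(cvg_shiftn `|k0|.+1) (_ : (fun n => _) = fun=> f k0); first exact: cvg_cst.
by apply/funext => n; rewrite (zwin_single f0)// addnC ltnS leq_addr.
Qed.

Lemma zabs_geometric f (C rho : R) : 0 <= rho < 1 ->
  (forall k, `|f k| <= C * rho ^+ `|k|%N) -> zabs f.
Proof.
move=> r01 fC; have [B hB] := nabs_geometric C r01.
have /andP[r0 r1] := r01.
apply/zabs_nabs; split.
  exists B => N; apply: le_trans (hB N); apply: ler_sum => i _.
  exact: le_trans (fC i) (ler_norm _).
exists B => N; apply: le_trans (hB N); apply: ler_sum => i _.
apply: le_trans (fC _) _; apply: le_trans (ler_norm _) _ => /=.
rewrite !normrM ler_wpM2l//= !(ger0_norm (exprn_ge0 _ r0)).
by rewrite exprS ler_piMl ?exprn_ge0// ltW.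
Qed.

(** Tannery: a dominated pointwise limit passes under the sum; only a finite
    window matters up to the tail of the dominating sum. *)
Lemma zsum_tannery (F : nat -> int -> R) f g : zabs g ->
  (forall n k, `|F n k| <= g k) ->
  (forall k, (fun n => F n k) @ \oo --> f k) ->
  (fun n => zsum (F n)) @ \oo --> zsum f.
Proof.
move=> gz Fg Ff.
have fg k : `|f k| <= g k.
  have Fk : (fun n => `|F n k|) @ \oo --> `|f k| by apply: cvg_norm; exact: Ff.
  rewrite -(cvg_lim _ Fk)//; apply: limr_le; first by apply/cvg_ex; eexists; exact: Fk.
  by near=> n; exact: Fg.
have g0 k : 0 <= g k by exact: le_trans (normr_ge0 _) (fg k).
have dom h : (forall k, `|h k| <= g k) -> zabs h.
  by move=> hg; apply: le_zabs gz _ => k; exact: le_trans (hg k) (ler_norm _).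
have tail h N : (forall k, `|h k| <= g k) -> `|zsum h - zwin h N| <= zsum g - zwin g N.
  move=> hg; have hz := dom _ hg.
  have hc : (fun n => `|zwin h n - zwin h N|) @ \oo --> `|zsum h - zwin h N|.
    by apply: cvg_norm; apply: cvgB; [exact: zabs_cvg|exact: cvg_cst].
  have gc : (fun n => zwin g n - zwin g N) @ \oo --> zsum g - zwin g N.
    by apply: cvgB; [exact: zabs_cvg|exact: cvg_cst].
  apply: (ler_cvg_to hc gc); near=> n.
  have Nn : (N <= n)%N by near: n; exact: nbhs_infty_ge.
  have addKr' (a b : R) : a + b - a = b by ring.
  rewrite /zwin -(subnKC Nn) !big_split_ord /= !addKr'.
  apply: le_trans (ler_norm_sum _ _ _) _; apply: ler_sum => i _.
  exact: le_trans (ler_normD _ _) (lerD (hg _) (hg _)).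
apply/cvgrPdist_le => e e0.
have e4 : 0 < e / 4 by rewrite divr_gt0.
have [N gN] : exists N, zsum g - zwin g N <= e / 4.
  have /cvgrPdist_le/(_ _ e4)[N _ /(_ N (leqnn N))/=] := zabs_cvg gz.
  by move=> h; exists N; exact: le_trans (ler_norm _) h.
have Fw : (fun n => zwin (F n) N) @ \oo --> zwin f N.
  apply: cvg_big => [|i _]; first exact: add_continuous.
  by apply: cvgD; exact: Ff.
have /cvgrPdist_le/(_ _ e4) Fe := Fw.
near=> n.
have h1 := le_trans (tail f N fg) gN.
have h2 := le_trans (tail (F n) N (Fg n)) gN.
have h3 : `|zwin f N - zwin (F n) N| <= e / 4 by near: n.
rewrite (_ : zsum f - zsum (F n) = (zsum f - zwin f N) + (zwin f N - zwin (F n) N)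
   - (zsum (F n) - zwin (F n) N)); last by ring.
apply: le_trans (ler_normB _ _) _; apply: le_trans (lerD (ler_normD _ _) (lexx _)) _.
by move: h1 h2 h3; lra.
Unshelve. all: by end_near. Qed.

Lemma nneseries_fin_nabs u : (forall n, 0 <= u n) ->
  (\sum_(n <oo) (u n)%:E < +oo)%E <-> nabs u.
Proof.
move=> u0; split=> [uy|[B uB]].
  have ufin : (\sum_(n <oo) (u n)%:E \is a fin_num)%E.
    by rewrite ge0_fin_numE// nneseries_ge0// => n _ _; rewrite lee_fin.
  exists (fine (\sum_(n <oo) (u n)%:E)) => N.
  rewrite -lee_fin fineK//; under eq_bigr do rewrite ger0_norm//.
  rewrite -sumEFin -(big_mkord xpredT (fun n => (u n)%:E)).
  by apply: nneseries_lim_ge => n _ _; rewrite lee_fin.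
apply: (@le_lt_trans _ _ B%:E); last exact: ltry.
apply: lime_le; first by apply: is_cvg_nneseries => n _ _; rewrite lee_fin.
apply: nearW => N; rewrite big_mkord sumEFin lee_fin.
by under eq_bigr do rewrite -(ger0_norm (u0 _)).
Qed.

Lemma nneseries_nabs u : (forall n, 0 <= u n) -> nabs u ->
  (\sum_(n <oo) (u n)%:E)%E = (limn (series u))%:E.
Proof.
move=> u0 un; rewrite -EFin_lim; last exact: nabs_cvg.
by apply: congr_lim; apply/funext => N; rewrite /= /series sumEFin.
Qed.

Lemma zabs_zsummable f : zabs f -> zsummable f.
Proof.
move=> /zabs_nabs[fP fN]; rewrite /zsummable /summable.
rewrite (esumID (range Posz)) ?setTI//.
have -> : ~` range Posz = range Negz.
  apply/seteqP; split => [[n|n] /= h|_ [n _ <-]] /=.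
  - by case: h; exists n.
  - by exists n.
  - by case=> k.
rewrite !esum_image//; last 2 first.
- by move=> n n' _ _ [].
- by move=> n n' _ _ [].
rewrite -!nneseries_esumT// lte_add_pinfty//.
  apply/(@nneseries_fin_nabs (fun n => `|f (Posz n)|)) => //.
  by apply: le_nabs fP _ => n; rewrite normr_id.
apply/(@nneseries_fin_nabs (fun n => `|f (Negz n)|)) => //.
by apply: le_nabs fN _ => n; rewrite normr_id.
Qed.

End Sums.

Section NatSums.
Context {R : realType}.
Implicit Types (u v : nat -> R).

Definition nsum u : R := limn (series u).

Lemma nsum_cvg u : nabs u -> series u @ \oo --> nsum u.
Proof. by move/nabs_cvg. Qed.

Lemma nsumP u l : series u @ \oo --> l -> nsum u = l.
Proof. by move/cvg_lim; apply. Qed.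

Lemma eq_nsum u v : u =1 v -> nsum u = nsum v.
Proof. by move=> /funext ->. Qed.

Lemma nabsD u v : nabs u -> nabs v -> nabs (fun n => u n + v n).
Proof.
move=> [B uB] [C vC]; exists (B + C) => N.
apply: le_trans (lerD (uB N) (vC N)); rewrite -big_split.
by apply: ler_sum => i _; exact: ler_normD.
Qed.

Lemma nabsZ c u : nabs u -> nabs (fun n => c * u n).
Proof.
move=> [B uB]; exists (`|c| * B) => N; under eq_bigr do rewrite normrM.
by rewrite -mulr_sumr ler_wpM2l.
Qed.

Lemma nabsB u v : nabs u -> nabs v -> nabs (fun n => u n - v n).
Proof.
move=> uz vz; rewrite (_ : (fun n => _) = fun n => u n + (-1) * v n); last first.
  by apply/funext => n; rewrite mulN1r.
by apply: nabsD => //; exact: nabsZ.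
Qed.

Lemma nabsS u : nabs u -> nabs (fun n => u n.+1).
Proof.
by move=> [B uB]; exists B => N; apply: le_trans (uB N.+1); rewrite big_ord_recl lerDr.
Qed.

Lemma nsumD u v : nabs u -> nabs v -> nsum (fun n => u n + v n) = nsum u + nsum v.
Proof.
move=> uz vz; apply: nsumP.
rewrite (_ : series _ = series u \+ series v); first by apply: cvgD; exact: nsum_cvg.
by apply/funext => N; rewrite /series /= big_split.
Qed.

Lemma nsumZ c u : nabs u -> nsum (fun n => c * u n) = c * nsum u.
Proof.
move=> uz; apply: nsumP.
rewrite (_ : series _ = fun N => c * series u N); first by apply: cvgMr; exact: nsum_cvg.
by apply/funext => N; rewrite /series /= mulr_sumr.
Qed.

Lemma nsumB u v : nabs u -> nabs v -> nsum (fun n => u n - v n) = nsum u - nsum v.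
Proof.
move=> uz vz; rewrite -mulN1r -nsumZ// -nsumD//; last exact: nabsZ.
by apply: eq_nsum => n; rewrite mulN1r.
Qed.

Lemma nsum_recl u : nabs u -> nsum u = u 0%N + nsum (fun n => u n.+1).
Proof.
move=> uz; have uS := nsum_cvg uz; rewrite -cvg_shiftS in uS.
apply: (cvg_unique _ uS) => //=.
under eq_fun do rewrite /series /= big_nat_recl//=.
by apply: cvgD; [exact: cvg_cst|exact: nsum_cvg (nabsS uz)].
Qed.

Lemma nsum_finite u N : (forall n, (N <= n)%N -> u n = 0) -> nsum u = \sum_(n < N) u n.
Proof.
move=> u0; apply: nsumP; rewrite -(cvg_shiftn N).
rewrite (_ : (fun n => _) = fun=> \sum_(n < N) u n); first exact: cvg_cst.
apply/funext => n; rewrite /series /= big_mkord addnC big_split_ord /=.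
by rewrite [X in _ + X]big1 ?addr0// => i _; rewrite u0// leq_addr.
Qed.

Lemma nsum_drop u N : nabs u -> (forall n, (n < N)%N -> u n = 0) ->
  nsum u = nsum (fun n => u (N + n)%N).
Proof.
elim: N u => [//|N IHN] u uz u0; rewrite nsum_recl// u0// add0r IHN//.
- exact: nabsS.
- by move=> n nN; exact: u0.
Qed.

Lemma ler_nsum u v : nabs u -> nabs v -> (forall n, u n <= v n) -> nsum u <= nsum v.
Proof.
move=> uz vz uv; apply: (ler_cvg_to (nsum_cvg uz) (nsum_cvg vz)).
by apply: nearW => N; rewrite /series /=; apply: ler_sum => i _.
Qed.

Lemma nsum_norm_le u v : nabs v -> (forall n, `|u n| <= v n) -> `|nsum u| <= nsum v.
Proof.
move=> vz uv; have uz : nabs u.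
  by apply: le_nabs vz _ => n; exact: le_trans (uv n) (ler_norm _).
rewrite ler_norml -mulN1r -nsumZ//; apply/andP; split.
  apply: ler_nsum => //; first exact: nabsZ.
  by move=> n; rewrite mulN1r; move: (uv n); rewrite ler_norml => /andP[].
by apply: ler_nsum => // n; exact: le_trans (ler_norm _) (uv n).
Qed.

Lemma cvg_lipschitz (u e : nat -> R) (l C : R) :
  (\forall n \near \oo, `|u n - l| <= C * `|e n|) -> e @ \oo --> (0 : R) ->
  u @ \oo --> l.
Proof.
move=> uC e0.
have Ce : (fun n => C * `|e n|) @ \oo --> (0 : R).
  by rewrite -(mulr0 C) -(normr0 R); apply: cvgMr; exact: cvg_norm.
apply/cvgrPdist_le => eps eps0; move/cvgrPdist_le/(_ _ eps0): Ce => Ce.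
near=> n; have h1 : `|u n - l| <= C * `|e n| by near: n.
have h2 : `|0 - C * `|e n| | <= eps by near: n.
rewrite distrC (le_trans h1)// (le_trans (ler_norm _))//.
by rewrite -normrN -sub0r.
Unshelve. all: by end_near. Qed.

End NatSums.

(** * q-shifted factorials and the weight *)

Section QPochhammer.
Context {R : realType} (q : R) (hq0 : 0 < q) (hq1 : q < 1).

Lemma q_neq0 : q != 0. Proof. by rewrite gt_eqF. Qed.

Lemma qX01 n : 0 <= q ^+ n <= 1.
Proof. by rewrite exprn_ge0 ?exprn_ile1 ?ltW. Qed.

Lemma qXn_inj (n n' : nat) : n != n' -> q ^+ n != q ^+ n'.
Proof.
move=> nn'; rewrite neq_lt; case: (ltngtP n n') nn' => // h _.
  by rewrite !(ltr_iXn2l hq0 hq1) h orbT.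
by rewrite !(ltr_iXn2l hq0 hq1) h.
Qed.

Lemma qz_inj (r s : int) : q ^ r = q ^ s -> r = s.
Proof.
wlog rs : r s / r <= s => [hw h|].
  by case/orP: (le_total r s) => rs; [|symmetry]; apply: hw.
have {1 2}-> : s = r + `|s - r|%N by lia.
rewrite expfzDr ?q_neq0// -[LHS]mulr1 => /(mulfI (expfz_neq0 _ q_neq0)).
rewrite -exprnP; case: `|s - r|%N => [|n]; first by rewrite addr0.
by rewrite -[1](expr0 q) => h; have := @qXn_inj 0 n.+1 isT; rewrite h eqxx.
Qed.

Lemma qpoch0 (a : R) : qpoch a q 0 = 1.
Proof. by rewrite /qpoch big_ord0. Qed.

Lemma qpochSr (a : R) n : qpoch a q n.+1 = qpoch a q n * (1 - a * q ^+ n).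
Proof. by rewrite /qpoch big_ord_recr. Qed.

Lemma qpochSl (a : R) n : qpoch a q n.+1 = (1 - a) * qpoch (a * q) q n.
Proof.
rewrite /qpoch big_ord_recl expr0 mulr1; congr (_ * _).
by apply: eq_bigr => i _; rewrite lift0 exprS mulrA.
Qed.

(** From [1 + y <= exp y] and the geometric series. *)
Lemma qpoch_le_exp (a : R) n : `|qpoch a q n| <= expR (`|a| / (1 - q)).
Proof.
apply: (@le_trans _ _ (expR (\sum_(k < n) `|a| * q ^+ k))).
  elim: n => [|n IHn]; first by rewrite qpoch0 big_ord0 expR0 normr1.
  rewrite qpochSr big_ord_recr /= expRD normrM ler_pM//.
  apply: le_trans (expR_ge1Dx _); rewrite (le_trans (ler_normB _ _))//.
  by rewrite normr1 normrM (ger0_norm (exprn_ge0 _ (ltW hq0))).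
rewrite ler_expR.
have -> : \sum_(k < n) `|a| * q ^+ k = series (geometric `|a| q) n.
  by rewrite /series /= big_mkord.
rewrite geometric_seriesE ?lt_eqF//= ler_wpM2r ?invr_ge0 ?subr_ge0 ?(ltW hq1)//.
by rewrite ler_piMr// lerBlDr lerDl exprn_ge0// ltW.
Qed.

Lemma qpoch_cvg (a : R) : qpoch a q n @[n --> \oo] --> qpoch_inf a q.
Proof.
suff: cvgn (fun n => qpoch a q n) by [].
have : cvgn (series (fun n => qpoch a q n.+1 - qpoch a q n)).
  apply: nabs_cvg; apply: le_nabs (nabs_geometric (expR (`|a| / (1 - q)) * `|a|) (_ : 0 <= q < 1)) _.
    by rewrite ltW.
  move=> n; rewrite qpochSr mulrBr mulr1 [_ - _ - _]addrAC subrr add0r normrN.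
  rewrite !normrM normr_id mulrA ler_wpM2r// ler_wpM2r// [leRHS]ger0_norm ?expR_ge0//.
  exact: qpoch_le_exp.
move=> /cvg_ex[/= l hl]; apply/cvg_ex; exists (1 + l).
rewrite (_ : (fun n => _) = (fun n => 1 + series (fun n => qpoch a q n.+1 - qpoch a q n) n)).
  by apply: cvgD => //; exact: cvg_cst.
apply/funext => n; rewrite /series /=.
by rewrite telescope_sumr// qpoch0 addrC subrK.
Qed.

Lemma qpoch_infS (a : R) : qpoch_inf a q = (1 - a) * qpoch_inf (a * q) q.
Proof.
have h := @qpoch_cvg a; rewrite -cvg_shiftS in h.
apply: (cvg_unique _ h) => //=.
under eq_fun do rewrite qpochSl.
by apply: cvgMr; exact: qpoch_cvg.
Qed.

Lemma qpoch_ge1 (a : R) n : a <= 0 -> 1 <= qpoch a q n.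
Proof.
move=> a0; elim: n => [|n IHn]; first by rewrite qpoch0.
rewrite qpochSr mulr_ege1// lerDl oppr_ge0 mulr_le0_ge0//.
by case/andP: (qX01 n).
Qed.

Lemma qpoch_inf_ge1 (a : R) : a <= 0 -> 1 <= qpoch_inf a q.
Proof.
move=> a0; apply: limr_ge; first by apply/cvg_ex; eexists; exact: qpoch_cvg.
by apply: nearW => n; exact: qpoch_ge1.
Qed.

Lemma qpoch_inf_neq0 (a : R) : a <= 0 -> qpoch_inf a q != 0.
Proof. by move=> /qpoch_inf_ge1 h; rewrite gt_eqF// (lt_le_trans ltr01 h). Qed.

(** Bounded below because [1 / (1 - y) <= 1 + y / (1 - q)] for [0 <= y <= q],
    and the product of the right-hand sides over the powers of [q] converges. *)
Lemma qfact_lb : exists2 c : R, 0 < c & forall n, c <= qpoch q q n.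
Proof.
set a := - (q / (1 - q)).
have q1 : 0 < 1 - q by rewrite subr_gt0.
have a0 : a <= 0 by rewrite oppr_le0 divr_ge0 ?ltW.
have key n : 1 <= qpoch q q n * qpoch a q n.
  elim: n => [|n IHn]; first by rewrite !qpoch0 mulr1.
  rewrite !qpochSr mulrACA mulr_ege1//.
  have /andP[y0 y1] := qX01 n; set y := q ^+ n in y0 y1 *.
  have -> : (1 - q * y) * (1 - a * y) = 1 + q ^+ 2 * y * (1 - y) / (1 - q).
    by rewrite /a; field; rewrite gt_eqF.
  by rewrite lerDl divr_ge0 ?(ltW q1)// !mulr_ge0 ?exprn_ge0 ?subr_ge0// ltW.
exists (expR (`|a| / (1 - q)))^-1 => [|n]; first by rewrite invr_gt0 expR_gt0.
rewrite -[leLHS]mul1r ler_pdivrMr ?expR_gt0//; apply: le_trans (key n) _.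
have p0 : 0 <= qpoch q q n.
  rewrite /qpoch prodr_ge0// => i _; rewrite subr_ge0 -exprS.
  by case/andP: (qX01 i.+1).
rewrite ler_wpM2l//; apply: le_trans (ler_norm _) (qpoch_le_exp _ _).
Qed.

Lemma qfact_gt0 n : 0 < qpoch q q n.
Proof. by have [c c0 /(_ n)] := qfact_lb; exact: lt_le_trans. Qed.

Lemma qfact_neq0 n : qpoch q q n != 0.
Proof. by rewrite gt_eqF ?qfact_gt0. Qed.

Lemma qfact_inf_gt0 : 0 < qpoch_inf q q.
Proof.
have [c c0 hc] := qfact_lb; apply: lt_le_trans c0 _.
apply: limr_ge; first by apply/cvg_ex; eexists; exact: qpoch_cvg.
by apply: nearW => n; exact: hc.
Qed.

Lemma qfact_inf_neq0 : qpoch_inf q q != 0.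
Proof. by rewrite gt_eqF ?qfact_inf_gt0. Qed.

Lemma qfact_ge_inf n : qpoch_inf q q <= qpoch q q n.
Proof.
apply: (@nonincreasing_cvgn_ge _ (fun n => qpoch q q n)).
  apply/nonincreasing_seqP => m; rewrite qpochSr ler_piMr ?(ltW (qfact_gt0 _))//.
  by rewrite gerBl -exprS; case/andP: (qX01 m.+1).
by apply/cvg_ex; eexists; exact: qpoch_cvg.
Qed.

(** [1 / (q;q)_k], with its entire extension [0] to negative [k]; the
    recurrence below then holds for all integers. *)
Definition rq (k : int) : R := if k is Posz n then (qpoch q q n)^-1 else 0.

Lemma rq0 : rq 0 = 1. Proof. by rewrite /= qpoch0 invr1. Qed.

Lemma rq_lt0 k : k < 0 -> rq k = 0. Proof. by case: k. Qed.

Lemma rq_ge0 k : 0 <= rq k.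
Proof. by case: k => n //=; rewrite invr_ge0 ltW ?qfact_gt0. Qed.

Lemma rq_le k : rq k <= (qpoch_inf q q)^-1.
Proof.
case: k => n /=; last by rewrite invr_ge0 ltW ?qfact_inf_gt0.
by rewrite lef_pV2 ?posrE ?qfact_gt0 ?qfact_inf_gt0 ?qfact_ge_inf.
Qed.

Lemma rq_rec k : rq k = (1 - q ^ (k + 1)) * rq (k + 1).
Proof.
case: k => [n|[|n]]; last 2 first.
- by rewrite /= subrr mul0r.
- by rewrite [Negz _ + 1](_ : _ = Negz n) ?mulr0//; lia.
rewrite (_ : Posz n + 1 = n.+1); last by lia.
rewrite [rq n]/= [rq n.+1]/= qpochSr exprSz.
have : 1 - q * q ^+ n != 0.
  by have := qfact_neq0 n.+1; rewrite qpochSr mulf_eq0 negb_or => /andP[].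
have := qfact_neq0 n; rewrite -exprnP => *.
by rewrite invfM mulrCA mulfV ?mulr1.
Qed.

Lemma rq_cvg : (fun n => rq (Posz n)) @ \oo --> (qpoch_inf q q)^-1.
Proof. by apply: cvgV; [exact: qfact_inf_neq0|exact: qpoch_cvg]. Qed.

Lemma qpochz0 (a : R) : a <= 0 -> qpochz a q 0 = 1.
Proof. by move=> a0; rewrite /qpochz expr0z mulr1 divff ?qpoch_inf_neq0. Qed.

Lemma qpochzS (a : R) (r : int) : a <= 0 ->
  qpochz a q (r + 1) = qpochz a q r * (1 - a * q ^ r).
Proof.
move=> a0; have aq s : a * q ^ s <= 0 by rewrite mulr_le0_ge0// exprz_ge0// ltW.
have qr : a * q ^ r * q = a * q ^ (r + 1) by rewrite expfzDr ?q_neq0// mulrA.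
rewrite /qpochz (qpoch_infS (a * q ^ r)) qr.
have h1 := qpoch_inf_neq0 (aq (r + 1)).
have h2 : 1 - a * q ^ r != 0.
  by rewrite gt_eqF// (lt_le_trans ltr01)// lerDl oppr_ge0.
by field; rewrite h1 h2.
Qed.

Lemma qpochz_nat (a : R) (n : nat) : a <= 0 -> qpochz a q n = qpoch a q n.
Proof.
move=> a0; elim: n => [|n IHn]; first by rewrite qpochz0 // qpoch0.
by rewrite -[in LHS]addn1 PoszD qpochzS// IHn qpochSr.
Qed.

Lemma qpochz_gt0 (a : R) (r : int) : a <= 0 -> 0 < qpochz a q r.
Proof.
move=> a0; rewrite divr_gt0// (lt_le_trans ltr01)// qpoch_inf_ge1//.
by rewrite mulr_le0_ge0// exprz_ge0// ltW.
Qed.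

Lemma qpochz_neq0 (a : R) (r : int) : a <= 0 -> qpochz a q r != 0.
Proof. by move=> a0; rewrite gt_eqF// qpochz_gt0. Qed.

(** The product of the [B * q^j] can only grow as long as [B * q^j > 1]. *)
Lemma gauss_bound (B : R) : 0 <= B ->
  exists2 C : R, 0 <= C & forall n : nat, B ^+ n * q ^+ 'C(n, 2) <= C.
Proof.
move=> B0.
have [n0 hn0] : exists n0, forall n, (n0 <= n)%N -> B * q ^+ n <= 1.
  have /cvgrPdist_le/(_ _ ltr01)[n0 _ h] : (fun n => B * q ^+ n) @ \oo --> B * (0 : R).
    by apply: cvgMr; apply: cvg_expr; rewrite ger0_norm ?ltW.
  exists n0 => n /h /=; rewrite mulr0 sub0r normrN ger0_norm//.
  by rewrite mulr_ge0// exprn_ge0// ltW.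
set D := Num.max 1 B; have D1 : 1 <= D by rewrite le_max lexx.
exists (D ^+ n0) => [|n]; first by rewrite exprn_ge0// (le_trans ler01).
suff : B ^+ n * q ^+ 'C(n, 2) <= D ^+ minn n n0.
  by move=> /le_trans; apply; rewrite ler_weXn2l// geq_minr.
elim: n => [|n IHn]; first by rewrite min0n mulr1.
rewrite binS bin1 exprD exprS.
rewrite (_ : _ * _ * _ = (B ^+ n * q ^+ 'C(n, 2)) * (B * q ^+ n)); last by ring.
have u0 : 0 <= B ^+ n * q ^+ 'C(n, 2) by rewrite mulr_ge0 ?exprn_ge0// ltW.
have v0 : 0 <= B * q ^+ n by rewrite mulr_ge0 ?exprn_ge0// ltW.
have [nn|nn] := ltnP n n0.
  move: IHn; rewrite (minn_idPl (ltnW nn)) (minn_idPl nn) exprSr => IHn.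
  rewrite ler_pM//; have /andP[y0 y1] := qX01 n.
  by apply: (@le_trans _ _ B); rewrite ?ler_piMr// le_max lexx orbT.
move: IHn; rewrite (minn_idPr nn) (minn_idPr (leqW nn)) => IHn.
by rewrite -[leRHS]mulr1 ler_pM// hn0.
Qed.

End QPochhammer.

Section Tempered.
Context {R : realType}.
Implicit Types f g : int -> R.

(** At most exponential growth in both directions. *)
Definition tempered (f : int -> R) :=
  exists C B : R, [/\ 0 <= C, 1 <= B & forall k, `|f k| <= C * B ^+ `|k|%N].

Lemma tempered_bounded (f : int -> R) C : (forall k, `|f k| <= C) -> tempered f.
Proof.
move=> fC; exists C, 1; split=> // [|k]; last by rewrite expr1n mulr1.
exact: le_trans (normr_ge0 _) (fC 0).
Qed.

Lemma tempered_cst c : tempered (fun=> c).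
Proof. by exists `|c|, 1; split=> // k; rewrite expr1n mulr1. Qed.

Lemma temperedM f g : tempered f -> tempered g -> tempered (fun k => f k * g k).
Proof.
move=> [C [B [C0 B1 fB]]] [C' [B' [C'0 B'1 gB]]]; exists (C * C'), (B * B').
split; [exact: mulr_ge0|exact: mulr_ege1|move=> k].
by rewrite normrM exprMn mulrACA ler_pM.
Qed.

Lemma temperedD f g : tempered f -> tempered g -> tempered (fun k => f k + g k).
Proof.
move=> [C [B [C0 B1 fB]]] [C' [B' [C'0 B'1 gB]]]; exists (C + C'), (B * B').
have B0 := le_trans ler01 B1; have B'0 := le_trans ler01 B'1.
split; [exact: addr_ge0|exact: mulr_ege1|move=> k].
apply: le_trans (ler_normD _ _) _; rewrite mulrDl exprMn lerD//.
  apply: le_trans (fB k) _; rewrite ler_wpM2l// ler_peMr ?exprn_ge0//.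
  by rewrite exprn_ege1.
apply: le_trans (gB k) _; rewrite ler_wpM2l// ler_peMl ?exprn_ge0//.
by rewrite exprn_ege1.
Qed.

Lemma eq_tempered f g : f =1 g -> tempered f -> tempered g.
Proof. by move=> /funext ->. Qed.

Lemma temperedZ c f : tempered f -> tempered (fun k => c * f k).
Proof. by apply: temperedM; exact: tempered_cst. Qed.

Lemma temperedB f g : tempered f -> tempered g -> tempered (fun k => f k - g k).
Proof.
move=> fT gT; apply: (@eq_tempered (fun k => f k + (-1) * g k)).
  by move=> k; rewrite mulN1r.
by apply: temperedD => //; exact: temperedZ.
Qed.

Lemma tempered_shift f : tempered f -> tempered (fun k => f (k + 1)).
Proof.
move=> [C [B [C0 B1 fB]]]; have B0 := le_trans ler01 B1.
exists (C * B), B; split=> // [|k]; first exact: mulr_ge0.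
apply: le_trans (fB _) _; rewrite -mulrA -exprS ler_wpM2l// ler_weXn2l//; lia.
Qed.

Lemma tempered_shiftN f : tempered f -> tempered (fun k => f (k - 1)).
Proof.
move=> [C [B [C0 B1 fB]]]; have B0 := le_trans ler01 B1.
exists (C * B), B; split=> // [|k]; first exact: mulr_ge0.
apply: le_trans (fB _) _; rewrite -mulrA -exprS ler_wpM2l// ler_weXn2l//; lia.
Qed.

End Tempered.

Section Weight.
Context {R : realType} (q t : R) (hq0 : 0 < q) (hq1 : q < 1) (ht : 0 < t).

Definition node (k : int) : R := t * q ^ k.
Definition weight (k : int) : R := t ^ k * q ^ binz k.

Lemma node_gt0 k : 0 < node k.
Proof. by rewrite mulr_gt0// exprz_gt0. Qed.

Lemma node_neq0 k : node k != 0.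
Proof. by rewrite gt_eqF ?node_gt0. Qed.

Lemma nodeS (k : int) : node (k + 1) = q * node k.
Proof. by rewrite /node expfzDr ?gt_eqF// expr1z; ring. Qed.

Lemma binzS k : binz (k + 1) = binz k + (k + 1).
Proof.
rewrite /binz (_ : (k + 1) * (k + 1 + 1) = (k + 1) * 2 + k * (k + 1)); last by ring.
by rewrite divzMDl// addrC.
Qed.

Lemma weight_gt0 k : 0 < weight k.
Proof. by rewrite mulr_gt0// exprz_gt0. Qed.

Lemma weight_ge0 k : 0 <= weight k.
Proof. exact: ltW (weight_gt0 k). Qed.

Lemma weight0 : weight 0 = 1.
Proof. by rewrite /weight /binz mul0r div0z !expr0z mulr1. Qed.

Lemma weightS k : weight (k + 1) = node (k + 1) * weight k.
Proof.
rewrite /weight /node binzS !expfzDr ?gt_eqF// !expr1z.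
by rewrite !(mulrA, mulrAC _ _ t) [LHS](_ : _ = t ^ k * t * q ^ binz k * q ^ k * q); ring.
Qed.

Lemma weight_le k :
  weight k <= (t + t^-1) ^+ `|k|%N * q ^+ 'C(`|k|%N, 2).
Proof.
have T0 : 0 <= t + t^-1 by rewrite addr_ge0// ?invr_ge0 ltW.
case: k => n.
  elim: n => [|n IHn]; first by rewrite weight0 !mulr1.
  rewrite -[in leLHS]addn1 PoszD weightS -PoszD addn1 /= binS bin1 exprD exprS.
  rewrite [leRHS](_ : _ = (t + t^-1) * q ^+ n * ((t + t^-1) ^+ n * q ^+ 'C(n, 2))); last by ring.
  apply: ler_pM; rewrite ?weight_ge0// ?(ltW (node_gt0 _))//.
  apply: ler_pM; rewrite ?(ltW ht) ?exprz_ge0 ?(ltW hq0)//.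
    by rewrite lerDl invr_ge0 ltW.
  by rewrite exprSz ler_piMl ?exprn_ge0// ltW.
rewrite NegzE abszN /=; elim: n.+1 => [|{}n IHn].
  by rewrite oppr0 weight0 !mulr1.
have := weightS (- n.+1%:Z); rewrite (_ : - n.+1%:Z + 1 = - n%:Z); last by lia.
move=> /(congr1 (fun x => (node (- n%:Z))^-1 * x)).
rewrite mulKf ?node_neq0// => <-.
rewrite binS bin1 exprD exprS.
rewrite [leRHS](_ : _ = (t + t^-1) * q ^+ n * ((t + t^-1) ^+ n * q ^+ 'C(n, 2))); last by ring.
apply: ler_pM; rewrite ?weight_ge0// ?invr_ge0 ?(ltW (node_gt0 _))//.
rewrite /node invfM invr_expz opprK.
apply: ler_pM; rewrite ?invr_ge0 ?(ltW ht) ?exprz_ge0 ?(ltW hq0)//.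
by rewrite lerDr ltW.
Qed.

Lemma tempered_zabs f : tempered f -> zabs (fun k => weight k * f k).
Proof.
move=> [C [B [C0 B1 fB]]].
have T0 : 0 <= t + t^-1 by rewrite addr_ge0// ?invr_ge0 ltW.
have B0 : 0 <= B by exact: le_trans ler01 B1.
have TB0 : 0 <= (t + t^-1) * B * 2 by rewrite !mulr_ge0.
have [D D0 hD] := gauss_bound hq0 hq1 TB0.
apply: (@zabs_geometric _ _ (C * D) 2^-1).
  by rewrite invr_ge0 ler0n invf_lt1 ?ltr1n ?ltr0n.
move=> k; rewrite normrM (ger0_norm (weight_ge0 k)).
apply: le_trans (ler_pM (weight_ge0 k) (normr_ge0 _) (weight_le k) (fB k)) _.
set n := `|k|%N; rewrite exprVn -[leRHS]mulrA.
have -> : (t + t^-1) ^+ n * q ^+ 'C(n, 2) * (C * B ^+ n) =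
   C * (((t + t^-1) * B * 2) ^+ n * q ^+ 'C(n, 2) / 2 ^+ n).
  by rewrite !exprMn; field; rewrite expf_neq0.
by rewrite ler_wpM2l// ler_wpM2r// invr_ge0 exprn_ge0.
Qed.

Lemma tempered_node : tempered node.
Proof.
exists t, q^-1; split; rewrite ?invf_ge1 ?(ltW ht) ?(ltW hq1)// => k.
rewrite ger0_norm ?(ltW (node_gt0 _))// ler_wpM2l ?(ltW ht)//.
case: k => n.
  by rewrite -exprnP; apply: (@le_trans _ _ 1); [rewrite exprn_ile1 ?ltW|rewrite exprn_ege1// invf_ge1// ltW].
by rewrite NegzE abszN -exprz_inv.
Qed.

End Weight.

(** * The eigenvalue equation and the ladder relation *)

Section Sequences.
Context {R : realType} (q t : R) (hq0 : 0 < q) (hq1 : q < 1) (ht : 0 < t).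
Local Notation x := (node q t).
Local Notation w := (weight q t).
Implicit Types (f g : int -> R) (k : int).

Definition zdot f g : R := zsum (fun k => w k * (f k * g k)).

(** For [f k = phi_z (x k)] this is the q-difference equation of the
    1-phi-1 series.  After division by [x (k + 1)] the left-hand side and the
    last term form a symmetric operator with eigenvalue [z]. *)
Definition eigen (z : R) f := forall k,
  f k - f (k + 1) = x (k + 1) * (z * f (k + 1) - f (k + 1 + 1)).

(** Raises the spectral parameter: from [phi_z] to [phi_(q z)]. *)
Definition ladder (z : R) f g := forall k, g k = f k - z * x (k + 1) * f (k + 1).

Lemma zdot_zabs f g : tempered f -> tempered g ->
  zabs (fun k => w k * (f k * g k)).
Proof. by move=> fT gT; apply: tempered_zabs => //; exact: temperedM. Qed.

Lemma zdotC f g : zdot f g = zdot g f.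
Proof. by apply: eq_zsum => k; rewrite (mulrC (f k)). Qed.

Lemma ladder_up z f g k : eigen z f -> ladder z f g ->
  g k = f (k + 1) - x (k + 1) * f (k + 1 + 1).
Proof. by move=> fz fg; rewrite fg; have := fz k; lra. Qed.

Lemma ladder_diff z f g k : eigen z f -> ladder z f g ->
  g (k + 1) - g k = x (k + 1) * (1 - q * z) * f (k + 1 + 1).
Proof. by move=> fz fg; rewrite (ladder_up k fz fg) fg (nodeS _ _ (k + 1))//; ring. Qed.

Lemma ladder_down z f g k : eigen z f -> ladder z f g ->
  (1 - q * z) * f (k + 1) = g (k + 1) - q * z * g k.
Proof. by move=> fz fg; rewrite (ladder_up k fz fg) fg (nodeS _ _ (k + 1))//; ring. Qed.

(** The eigenvalue equation is symmetric for the weight, up to a telescoping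
    Wronskian that the weight forces to vanish at both ends. *)
Lemma eigen_orthogonal z z' f g : z != z' -> eigen z f -> eigen z' g ->
  tempered f -> tempered g -> zdot f g = 0.
Proof.
move=> zz' fz gz fT gT.
pose U k := w k * (f k * g (k + 1) - g k * f (k + 1)).
have Uz : zabs U.
  apply: tempered_zabs => //; apply: temperedB; apply: temperedM => //;
  exact: tempered_shift.
have key : zsum (fun k => (z - z') * (w (k + 1) * (f (k + 1) * g (k + 1)))) = 0.
  rewrite -[RHS](mulr0 (-1)) -(zsum_telescope Uz) -zsumZ; last first.
    by apply: zabsB => //; exact: zabs_shift.
  apply: eq_zsum => k; rewrite /U weightS//.
  rewrite (_ : f k = f (k + 1) + x (k + 1) * (z * f (k + 1) - f (k + 1 + 1))); last first.
    by rewrite -fz addrC subrK.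
  rewrite (_ : g k = g (k + 1) + x (k + 1) * (z' * g (k + 1) - g (k + 1 + 1))); last first.
    by rewrite -gz addrC subrK.
  ring.
have fgz := zdot_zabs fT gT.
rewrite zsumZ in key; last exact: (zabs_shift fgz).
rewrite (zsum_shift fgz) in key.
by move/eqP: key; rewrite mulf_eq0 subr_eq0 (negbTE zz') => /eqP.
Qed.

(** The ladder relation in [zdot g g] and its inverse [ladder_down] in
    [zdot f f] produce the same mixed sum; the remaining terms are multiples of
    [zdot f g]. *)
Lemma ladder_norm z f g : eigen z f -> ladder z f g -> tempered f -> tempered g ->
  zdot f g = 0 -> q * zdot g g = (1 - q * z) * zdot f f.
Proof.
move=> fz fg fT gT fg0.
have ffz := zdot_zabs fT fT; have fgz := zdot_zabs fT gT; have ggz := zdot_zabs gT gT.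
have sz : zabs (fun k => w (k + 1) * (f (k + 1) * g k)).
  apply: (@eq_zabs _ (fun k => w k * (f k * (x (k + 1) * g k) - (q * x k) * (f k - f (k + 1)) * g k))).
    by move=> k; rewrite weightS// -nodeS//; ring.
  apply: tempered_zabs => //; apply: temperedB.
    apply: temperedM => //; apply: temperedM => //.
    by apply: tempered_shift; exact: (tempered_node hq0 hq1 ht).
  apply: temperedM => //; apply: temperedM.
    by apply: temperedZ; exact: (tempered_node hq0 hq1 ht).
  by apply: temperedB => //; exact: tempered_shift.
have h1 : zdot g g = zdot f g - z * zsum (fun k => w (k + 1) * (f (k + 1) * g k)).
  rewrite /zdot -zsumZ// -zsumB//; last exact: zabsZ.
  by apply: eq_zsum => k; rewrite {1}fg weightS//; ring.
have h2 : (1 - q * z) * zdot f f =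
    zdot f g - q * z * zsum (fun k => w (k + 1) * (f (k + 1) * g k)).
  rewrite /zdot -(zsum_shift ffz) -(zsum_shift fgz).
  rewrite -(zsumZ (1 - q * z) (zabs_shift ffz)) -(zsumZ (q * z) sz).
  rewrite -(zsumB (zabs_shift fgz) (zabsZ (q * z) sz)).
  apply: eq_zsum => k.
  transitivity (w (k + 1) * f (k + 1) * ((1 - q * z) * f (k + 1))); first by ring.
  by rewrite (ladder_down k fz fg); ring.
by rewrite h2 h1 fg0; ring.
Qed.

(** The coefficients of the eigenvalue equation differ from those of
    [f k = f (k + 1)] by a summable amount as [k] tends to infinity, so a
    solution is controlled by its limit there. *)
Lemma eigen_eq0 z f : eigen z f -> (fun n => f (Posz n)) @ \oo --> (0 : R) ->
  forall k, f k = 0.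
Proof.
move=> fz f0.
pose a := (`|z| + 1) * (t * q).
have a0 : 0 <= a by rewrite mulr_ge0 ?addr_ge0// mulr_ge0// ltW.
pose M n := Num.max `|f (Posz n)| `|f (Posz n.+1)|.
have MS n : M n <= (1 + a * q ^+ n) * M n.+1.
  have M0 : 0 <= M n.+1 by rewrite le_max normr_ge0.
  have aq0 : 0 <= a * q ^+ n by rewrite mulr_ge0// exprn_ge0// ltW.
  rewrite {1}/M ge_max; apply/andP; split; last first.
    by apply: (@le_trans _ _ (M n.+1)); [rewrite le_max lexx|rewrite ler_peMl// lerDl].
  have xn : x (Posz n + 1) = t * q * q ^+ n.
    by rewrite nodeS// /node -exprnP; ring.
  have x0 : 0 <= x (Posz n + 1) by rewrite ltW// node_gt0.
  have h1 : `|f (Posz n + 1)| <= M n.+1 by rewrite le_max -PoszD addn1 lexx.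
  have h2 : `|f (Posz n + 1 + 1)| <= M n.+1 by rewrite le_max -!PoszD !addn1 lexx orbT.
  have -> : f n = f (Posz n + 1) + x (Posz n + 1) * (z * f (Posz n + 1) - f (Posz n + 1 + 1)).
    by rewrite -fz addrC subrK.
  apply: le_trans (ler_normD _ _) _; rewrite mulrDl mul1r lerD// normrM ger0_norm//.
  rewrite (_ : a * q ^+ n * M n.+1 = x (Posz n + 1) * ((`|z| + 1) * M n.+1)); last first.
    by rewrite xn /a; ring.
  rewrite ler_wpM2l//; apply: le_trans (ler_normB _ _) _.
  by rewrite mulrDl mul1r lerD// normrM ler_wpM2l.
have Mle n m : M n <= qpoch (- a) q (n + m) * M (n + m)%N.
  elim: m => [|m IHm].
    by rewrite addn0 ler_peMl ?le_max ?normr_ge0// qpoch_ge1// oppr_le0.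
  apply: le_trans IHm _; rewrite addnS qpochSr -mulrA mulNr opprK.
  rewrite ler_wpM2l//.
  by apply: le_trans ler01 (qpoch_ge1 hq0 hq1 _ _); rewrite oppr_le0.
have Mcv : (fun m => expR (`|- a| / (1 - q)) * M m) @ \oo --> (0 : R).
  rewrite -[X in _ --> X](mulr0 (expR (`|- a| / (1 - q)))); apply: cvgMr.
  have fS : (fun n => `|f (Posz n)|) @ \oo --> (0 : R).
    by rewrite -(normr0 R); exact: cvg_norm.
  have fSS : (fun n => `|f (Posz n.+1)|) @ \oo --> (0 : R) by rewrite (cvg_shiftS (fun n => `|f (Posz n)|)).
  rewrite -[X in _ --> X](addr0 0).
  apply: (@squeeze_cvgr _ _ _ _ (fun=> 0) (fun n => `|f (Posz n)| + `|f (Posz n.+1)|)).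
  - apply: nearW => n; rewrite le_max normr_ge0 /= ge_max.
    by rewrite lerDl lerDr !normr_ge0.
  - by rewrite addr0; exact: cvg_cst.
  - exact: cvgD.
have M0 n : M n = 0.
  apply/le_anti; rewrite [X in _ && X]le_max normr_ge0 andbT.
  rewrite -(cvg_lim _ Mcv)//; apply: limr_ge; first by apply/cvg_ex; eexists; exact: Mcv.
  near=> m; have nm : (n <= m)%N by near: m; exact: nbhs_infty_ge.
  apply: le_trans (Mle n (m - n)%N) _; rewrite subnKC//.
  rewrite ler_wpM2r ?le_max ?normr_ge0//.
  exact: le_trans (ler_norm _) (qpoch_le_exp hq0 hq1 _ _).
have f0P n : f (Posz n) = 0.
  by apply/normr0_eq0/le_anti; rewrite normr_ge0 andbT -(M0 n) le_max lexx.
have f0N n : f (- Posz n) = 0 /\ f (- Posz n + 1) = 0.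
  elim: n => [|n [IH1 IH2]]; first by rewrite oppr0 add0r !f0P.
  have e1 : - n.+1%:Z + 1 = - n%:Z by lia.
  split; last by rewrite e1.
  by have := fz (- n.+1%:Z); rewrite e1 IH1 IH2 mulr0 subr0 subr0 mulr0.
by case=> n; [exact: f0P|rewrite NegzE; case: (f0N n.+1)].
Unshelve. all: by end_near. Qed.

Lemma eigen_unique z f g l : eigen z f -> eigen z g ->
  (fun n => f (Posz n)) @ \oo --> (l : R) ->
  (fun n => g (Posz n)) @ \oo --> (l : R) -> f =1 g.
Proof.
move=> fz gz fl gl k; apply/eqP; rewrite -subr_eq0; apply/eqP.
apply: (@eigen_eq0 z (fun k => f k - g k)).
  move=> j; have := fz j; have := gz j.
  have -> : f j - g j - (f (j + 1) - g (j + 1)) = (f j - f (j + 1)) - (g j - g (j + 1)) by ring.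
  by move=> -> ->; ring.
by rewrite -(subrr l); exact: cvgB.
Qed.

End Sequences.

(** * The functions phi_z *)

Section Phi.
Context {R : realType} (q : R) (hq0 : 0 < q) (hq1 : q < 1).
Implicit Types (z x : R).

Lemma nabs_gauss (B : R) : 0 <= B -> nabs (fun n => B ^+ n * q ^+ 'C(n, 2)).
Proof.
move=> B0; have B20 : 0 <= B * 2 by rewrite mulr_ge0.
have [C C0 hC] := gauss_bound hq0 hq1 B20.
have r01 : 0 <= (2^-1 : R) < 1 by rewrite invr_ge0 ler0n invf_lt1 ?ltr1n ?ltr0n.
apply: le_nabs (nabs_geometric C r01) _ => n.
rewrite !ger0_norm ?mulr_ge0 ?exprn_ge0 ?invr_ge0 ?(ltW hq0)//.
rewrite exprVn.
rewrite [leLHS](_ : _ = B ^+ n * 2 ^+ n * q ^+ 'C(n, 2) / 2 ^+ n); last first.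
  by field; rewrite expf_neq0.
by rewrite ler_wpM2r ?invr_ge0 ?exprn_ge0// -exprMn; exact: hC.
Qed.

(** [(1/z;q)_n z^n], which unlike [(1/z;q)_n] makes sense at [z = 0]. *)
Definition zfact z n : R := \prod_(j < n) (z - q ^+ j).

Definition phicoef z x n : R :=
  zfact z n / qpoch q q n * q ^+ 'C(n.+1, 2) * x ^+ n.

Definition Phi z x : R := nsum (phicoef z x).

Lemma zfactS z n : zfact z n.+1 = zfact z n * (z - q ^+ n).
Proof. by rewrite /zfact big_ord_recr. Qed.

Lemma zfact_scale z n : zfact (q * z) n.+1 = q ^+ n * (q * z - 1) * zfact z n.
Proof.
rewrite /zfact big_ord_recl expr0 [q ^+ n * _]mulrC -mulrA; congr (_ * _).
rewrite -[n in q ^+ n](card_ord n) -prodr_const -big_split /=.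
by apply: eq_bigr => i _; rewrite /bump add1n exprS mulrBr.
Qed.

Lemma zfact_le z n : `|zfact z n| <= (1 + `|z|) ^+ n.
Proof.
elim: n => [|n IHn]; first by rewrite /zfact big_ord0 normr1.
rewrite zfactS normrM exprSr ler_pM//; apply: le_trans (ler_normB _ _) _.
have /andP[y0 y1] := qX01 hq0 hq1 n.
by rewrite (ger0_norm y0) addrC lerD2r.
Qed.

Lemma phicoefS z x n : phicoef z x n.+1 * (1 - q ^+ n.+1) =
  phicoef z x n * (z - q ^+ n) * q ^+ n.+1 * x.
Proof.
rewrite /phicoef zfactS qpochSr -exprS [in q ^+ 'C(n.+2, 2)]binS bin1 exprD.
have := qfact_neq0 hq0 hq1 n.+1.
rewrite qpochSr -exprS mulf_eq0 negb_or => /andP[h1 h2].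
by rewrite [x ^+ n.+1]exprSr; set y := q ^+ n.+1 in h2 *; field; rewrite h1 h2.
Qed.

Lemma phicoef_le z x n :
  `|phicoef z x n| <= (qpoch_inf q q)^-1 * (((1 + `|z|) * `|x|) ^+ n * q ^+ 'C(n, 2)).
Proof.
rewrite /phicoef !normrM (normrX _ x) exprMn.
rewrite (ger0_norm (exprn_ge0 _ (ltW hq0))).
rewrite [leRHS](_ : _ = (1 + `|z|) ^+ n * (qpoch_inf q q)^-1 * q ^+ 'C(n, 2) * `|x| ^+ n); last by ring.
rewrite ler_wpM2r ?exprn_ge0// ler_pM ?mulr_ge0 ?exprn_ge0 ?(ltW hq0)//.
  rewrite ler_pM ?zfact_le// normfV gtr0_norm ?qfact_gt0//.
  exact: (rq_le hq0 hq1 n).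
by rewrite binS bin1 exprD ler_piMr ?exprn_ge0 ?exprn_ile1 ?ltW.
Qed.

Lemma phicoef_nabs z x : nabs (phicoef z x).
Proof.
have B0 : 0 <= (1 + `|z|) * `|x| by rewrite mulr_ge0// addr_ge0.
apply: le_nabs (nabsZ (qpoch_inf q q)^-1 (nabs_gauss B0)) _ => n.
by apply: le_trans (phicoef_le z x n) (ler_norm _).
Qed.

Lemma phiE z x : z != 0 -> phi q z x = Phi z x.
Proof.
move=> z0; rewrite /phi /Phi /nsum; congr (limn (series _)); apply/funext => n.
rewrite /phicoef; congr (_ * _ * _); rewrite mulrAC; congr (_ / _).
rewrite /qpoch /zfact -[n in z ^+ n](card_ord n) -prodr_const -big_split /=.
by apply: eq_bigr => i _; field.
Qed.

Lemma Phi_eigen z x :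
  Phi z x - Phi z (q * x) = q * x * (z * Phi z (q * x) - Phi z (q * (q * x))).
Proof.
rewrite /Phi -nsumZ; last exact: phicoef_nabs.
rewrite -!nsumB; do ?exact: phicoef_nabs; last exact/nabsZ/phicoef_nabs.
rewrite -nsumZ; last first.
  by apply: nabsB; [exact/nabsZ/phicoef_nabs|exact: phicoef_nabs].
have scale c y n : phicoef z (c * y) n = c ^+ n * phicoef z y n.
  by rewrite /phicoef exprMn; ring.
rewrite nsum_recl.
  rewrite {1 2}/phicoef !expr0 !mulr1 subrr add0r.
  apply: eq_nsum => n; rewrite !scale.
  transitivity (phicoef z x n.+1 * (1 - q ^+ n.+1)); first by ring.
  by rewrite phicoefS exprS; ring.
by apply: nabsB; exact: phicoef_nabs.
Qed.

Lemma Phi_ladder z x : Phi (q * z) x = Phi z x - z * (q * x) * Phi z (q * x).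
Proof.
rewrite /Phi nsum_recl; last exact: phicoef_nabs.
rewrite [in RHS]nsum_recl; last exact: phicoef_nabs.
rewrite -nsumZ; last exact: phicoef_nabs.
rewrite -addrA -nsumB; last 2 first.
- exact/nabsS/phicoef_nabs.
- exact/nabsZ/phicoef_nabs.
congr (_ + _); first by rewrite /phicoef /zfact !big_ord0.
apply: eq_nsum => n; rewrite /phicoef zfact_scale zfactS qpochSr.
rewrite [in q ^+ 'C(n.+2, 2)]binS bin1 exprD exprMn [x ^+ n.+1]exprSr exprS.
have := qfact_neq0 hq0 hq1 n.+1.
rewrite qpochSr mulf_eq0 negb_or => /andP[h1 h2].
by field; rewrite h1 h2.
Qed.

Lemma Phi1 x : Phi 1 x = 1.
Proof.
rewrite /Phi (@nsum_finite _ _ 1) => [|[|n] // _]; last first.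
  by rewrite /phicoef /zfact big_ord_recl expr0 subrr !mul0r.
by rewrite big_ord1 /phicoef /zfact big_ord0 qpoch0 divr1 !mulr1.
Qed.

(** Continuity at the accumulation point [0] of the spectrum, with the
    dependence on [n] needed for dominated convergence in the series. *)
Lemma zfact_lipschitz z n : `|z| <= 1 -> `|zfact z n - zfact 0 n| <= `|z| * 2 ^+ n.
Proof.
move=> z1; elim: n => [|n IHn].
  by rewrite /zfact !big_ord0 subrr normr0 mulr1.
rewrite !zfactS.
rewrite (_ : _ - _ = zfact z n * z - q ^+ n * (zfact z n - zfact 0 n)); last by ring.
apply: le_trans (ler_normB _ _) _; rewrite !normrM exprS mulrCA mulr_natl mulr2n.
have /andP[y0 y1] := qX01 hq0 hq1 n.
apply: lerD; last first.
  by apply: le_trans IHn; rewrite ger0_norm// ler_piMl.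
rewrite mulrC ler_wpM2l//; apply: le_trans (zfact_le z n) _.
by rewrite lerXn2r ?nnegrE ?addr_ge0// -[leRHS]/(1 + 1) lerD2l.
Qed.

Lemma Phi_cvg0 (z_ : nat -> R) x : z_ @ \oo --> (0 : R) ->
  (fun n => Phi (z_ n) x) @ \oo --> Phi 0 x.
Proof.
move=> z0; have B0 : 0 <= 2 * `|x| by rewrite mulr_ge0.
pose g n := (qpoch_inf q q)^-1 * ((2 * `|x|) ^+ n * q ^+ 'C(n, 2)).
have gz : nabs g by apply: nabsZ; exact: nabs_gauss.
apply: (@cvg_lipschitz _ _ z_ _ (nsum g)) => //.
have /cvgrPdist_le/(_ _ ltr01) z1 := z0.
near=> n; have zn1 : `|z_ n| <= 1.
  by rewrite -normrN -sub0r; near: n.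
rewrite /Phi -nsumB; do ?exact: phicoef_nabs.
rewrite mulrC -nsumZ//; apply: nsum_norm_le; first exact: nabsZ.
move=> k; rewrite /phicoef /g -!mulrBl !normrM (normrX _ x).
rewrite (ger0_norm (exprn_ge0 _ (ltW hq0))).
rewrite exprMn [leRHS](_ : _ = `|z_ n| * 2 ^+ k * (qpoch_inf q q)^-1 * q ^+ 'C(k, 2) * `|x| ^+ k); last by ring.
rewrite ler_wpM2r ?exprn_ge0// ler_pM ?mulr_ge0 ?exprn_ge0 ?(ltW hq0)//.
  rewrite ler_pM ?zfact_lipschitz// normfV gtr0_norm ?qfact_gt0//.
  exact: (rq_le hq0 hq1 k).
by rewrite binS bin1 exprD ler_piMr ?exprn_ge0 ?exprn_ile1 ?ltW.
Unshelve. all: by end_near. Qed.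

Lemma Phi_cvg1 z (x_ : nat -> R) : x_ @ \oo --> (0 : R) ->
  (fun n => Phi z (x_ n)) @ \oo --> (1 : R).
Proof.
move=> x0; have B0 : 0 <= 1 + `|z| by rewrite addr_ge0.
pose g n := (qpoch_inf q q)^-1 * ((1 + `|z|) ^+ n * q ^+ 'C(n, 2)).
have gz : nabs g by apply: nabsZ; exact: nabs_gauss.
apply: (@cvg_lipschitz _ _ x_ _ (nsum (fun n => g n.+1))) => //.
have /cvgrPdist_le/(_ _ ltr01) x1 := x0.
near=> n; have xn1 : `|x_ n| <= 1.
  by rewrite -normrN -sub0r; near: n.
rewrite /Phi nsum_recl; last exact: phicoef_nabs.
rewrite {1}/phicoef /zfact big_ord0 qpoch0 divr1 !mulr1 [1 + _]addrC addrK.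
rewrite mulrC -nsumZ; last exact: nabsS.
apply: nsum_norm_le; first exact/nabsZ/nabsS.
move=> k; apply: le_trans (phicoef_le _ _ _) _.
rewrite exprMn [in `|x_ n| ^+ _]exprS /g.
rewrite [leLHS](_ : _ = `|x_ n| * ((qpoch_inf q q)^-1 * ((1 + `|z|) ^+ k.+1 * q ^+ 'C(k.+1, 2))) * `|x_ n| ^+ k); last by ring.
rewrite ler_piMr ?exprn_ile1// !mulr_ge0 ?invr_ge0 ?exprn_ge0 ?(ltW hq0)//.
by rewrite ltW// qfact_inf_gt0.
Unshelve. all: by end_near. Qed.

End Phi.

(** * Jackson's second q-Bessel function *)

Section Bessel.
Context {R : realType} (q : R) (hq0 : 0 < q) (hq1 : q < 1).
Implicit Types (tau T : R) (N : int) (j : nat).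
Local Notation K := (qpoch_inf q q)^-1.

(** For [tau < 0], the sum [J2 tau N] of these terms is
    [(- tau)^(- N/2) J^(2)_N(2 (- tau)^(1/2); q)] in Jackson's notation, rearranged
    so that only non-negative powers of [q] occur when [N >= 0].  The defining
    power series of [phi_z] does not show the size of the solution for negative
    [k]; this one does, with [tau = - t q^(- r)] and [N = k + r]. *)
Definition J2term tau N j : R :=
  tau ^+ j * q ^ (Posz j * (Posz j + N)) * rq q j * rq q (Posz j + N).

Definition J2 tau N : R := nsum (J2term tau N).

Lemma qz_le (n : nat) (m : int) : n%:Z <= m -> q ^ m <= q ^+ n.
Proof.
move=> nm; rewrite (_ : m = n%:Z + `|m - n%:Z|%N); last by lia.
rewrite expfzDr ?gt_eqF// -!exprnP ler_piMr ?exprn_ge0 ?exprn_ile1 ?ltW//.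
Qed.

Lemma qz_ge0 (m : int) : 0 <= q ^ m.
Proof. by rewrite exprz_ge0// ltW. Qed.

Lemma bin2_le j : ('C(j, 2) <= j * j)%N.
Proof. by elim: j => // j IHj; rewrite binS bin1; nia. Qed.

Lemma ler_pM4 (a b c d a' b' c' d' : R) : 0 <= a -> 0 <= b -> 0 <= c -> 0 <= d ->
  a <= a' -> b <= b' -> c <= c' -> d <= d' -> a * b * c * d <= a' * b' * c' * d'.
Proof. by move=> *; rewrite !ler_pM// !mulr_ge0. Qed.

Lemma J2term0 tau N : J2term tau N 0 = rq q N.
Proof.
rewrite /J2term (mul0r (0 + N) : Posz 0 * (Posz 0 + N) = 0).
by rewrite (add0r N : Posz 0 + N = N) expr0 expr0z rq0 !mul1r.
Qed.

Lemma J2term_le tau T (n j : nat) : `|tau| <= T ->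
  `|J2term tau n j| <= K ^+ 2 * (T ^+ j * q ^+ 'C(j, 2)).
Proof.
move=> tT; rewrite /J2term !normrM normrX (ger0_norm (qz_ge0 _)).
rewrite !(ger0_norm (rq_ge0 hq0 hq1 _)).
rewrite [leRHS](_ : _ = T ^+ j * q ^+ 'C(j, 2) * K * K); last by ring.
have T0 : 0 <= T by exact: le_trans tT.
have h1 : `|tau| ^+ j <= T ^+ j by rewrite lerXn2r// nnegrE.
have h2 : q ^ (j%:Z * (j%:Z + n)) <= q ^+ 'C(j, 2).
  by apply: qz_le; have := bin2_le j; nia.
have h0 := rq_ge0 hq0 hq1; have h3 := rq_le hq0 hq1.
exact: (ler_pM4 (exprn_ge0 _ (normr_ge0 _)) (qz_ge0 _) (h0 _) (h0 _) h1 h2 (h3 _) (h3 _)).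
Qed.

Lemma J2term_nabs_nat tau (n : nat) : nabs (J2term tau n).
Proof.
apply: le_nabs (nabsZ (K ^+ 2) (nabs_gauss hq0 hq1 (normr_ge0 tau))) _ => j.
exact: le_trans (J2term_le n j (lexx _)) (ler_norm _).
Qed.

Lemma J2term_neg tau N j : Posz j + N < 0 -> J2term tau N j = 0.
Proof. by move=> h; rewrite /J2term (rq_lt0 q h) mulr0. Qed.

Lemma J2term_opp tau (n i : nat) :
  J2term tau (- n%:Z) (n + i) = tau ^+ n * J2term tau n i.
Proof.
rewrite /J2term (_ : Posz (n + i) + - n%:Z = i); last by lia.
rewrite (_ : Posz (n + i) * i = i%:Z * (i%:Z + n)); last by lia.
by rewrite (_ : i%:Z + n = Posz (n + i)) ?exprD; [ring|lia].
Qed.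

Lemma J2term_nabs tau N : nabs (J2term tau N).
Proof.
case: N => n; first exact: J2term_nabs_nat.
rewrite NegzE; have [B hB] := nabsZ (tau ^+ n.+1) (J2term_nabs_nat tau n.+1).
have {}hB M : \sum_(i < M) `|J2term tau (- n.+1%:Z) (n.+1 + i)| <= B.
  by under eq_bigr do rewrite J2term_opp; exact: hB.
exists B => M; apply: le_trans (hB M).
have [Mn|nM] := leqP M n.+1.
  rewrite big1 ?sumr_ge0// => i _; rewrite J2term_neg ?normr0//.
  by have := ltn_ord i; lia.
rewrite -(subnKC (ltnW nM)) big_split_ord /= big1 ?add0r; last first.
  by move=> i _; rewrite J2term_neg ?normr0//; have := ltn_ord i; lia.
rewrite subnKC; last exact: ltnW.
rewrite -(big_mkord xpredT (fun i => `|J2term tau (- n.+1%:Z) (n.+1 + i)|)).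
rewrite -(big_mkord xpredT (fun i => `|J2term tau (- n.+1%:Z) (n.+1 + i)|)).
by rewrite [leRHS](big_cat_nat (leq0n _) (leq_subr n.+1 M))/= lerDl sumr_ge0.
Qed.

(** The terms with [j < n] vanish.  This carries the estimates for [N >= 0] over
    to negative [N], with at most exponential growth. *)
Lemma J2_opp tau (n : nat) : J2 tau (- n%:Z) = tau ^+ n * J2 tau n.
Proof.
rewrite /J2 (@nsum_drop _ _ n); last 2 first.
- exact: J2term_nabs.
- by move=> j jn; rewrite J2term_neg//; lia.
rewrite -nsumZ; last exact: J2term_nabs.
by apply: eq_nsum => i; exact: J2term_opp.
Qed.

(** Termwise up to a shift of the summation index, by the recurrence of [rq]. *)
Lemma J2_rec tau N :
  J2 tau N = (1 - q ^ (N + 1)) * J2 tau (N + 1) + tau * q ^ (N + 1) * J2 tau (N + 1 + 1).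
Proof.
have q0 : q != 0 by rewrite gt_eqF.
have h := J2term_nabs tau.
suff key : nsum (fun j => J2term tau N j - (1 - q ^ (N + 1)) * J2term tau (N + 1) j) =
    tau * q ^ (N + 1) * J2 tau (N + 1 + 1).
  move: key; rewrite nsumB//; last exact: nabsZ.
  by rewrite nsumZ// => <-; rewrite addrC subrK.
rewrite nsum_recl; last by apply: nabsB => //; exact: nabsZ.
rewrite !J2term0 -(rq_rec hq0 hq1) subrr add0r.
rewrite /J2 -nsumZ//; apply: eq_nsum => j; rewrite /J2term.
rewrite (_ : Posz j.+1 + (N + 1) = Posz j.+1 + N + 1); last by lia.
rewrite (_ : Posz j + (N + 1 + 1) = Posz j.+1 + N + 1); last by lia.
rewrite (rq_rec hq0 hq1 (Posz j.+1 + N)) (rq_rec hq0 hq1 j).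
rewrite (_ : Posz j + 1 = Posz j.+1); last by lia.
set J := Posz j.+1; set r := rq q (J + N + 1); set r' := rq q J.
have -> : q ^ (J * (J + N + 1)) = q ^ (J * (J + N)) * q ^ J.
  by rewrite -expfzDr//; congr (q ^ _); lia.
have e1 : q ^ (N + 1) * q ^ (Posz j * (J + N + 1)) = q ^ (J * (J + N)).
  by rewrite -expfzDr//; congr (q ^ _); rewrite /J; lia.
have -> : q ^ (J + N + 1) = q ^ J * q ^ (N + 1) by rewrite -addrA expfzDr.
transitivity (tau * tau ^+ j * q ^ (J * (J + N)) * (1 - q ^ J) * r' * r).
  by rewrite exprS; ring.
by rewrite -e1; ring.
Qed.

Definition J2bound T : R := K ^+ 2 * nsum (fun j => T ^+ j * q ^+ 'C(j, 2)).

Lemma J2_le tau T (n : nat) : `|tau| <= T -> `|J2 tau n| <= J2bound T.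
Proof.
move=> tT; have T0 : 0 <= T by exact: le_trans tT.
rewrite /J2bound -nsumZ; last exact: nabs_gauss.
apply: nsum_norm_le; first by apply: nabsZ; exact: nabs_gauss.
by move=> j; exact: J2term_le.
Qed.

Lemma J2bound_ge0 T : 0 <= T -> 0 <= J2bound T.
Proof.
by move=> T0; apply: le_trans (normr_ge0 _) (@J2_le T T 0 _); rewrite ger0_norm.
Qed.

Lemma J2_near tau T (n : nat) : `|tau| <= T ->
  `|J2 tau n - rq q n| <= `|tau| * q ^+ n * J2bound T.
Proof.
move=> tT; have T0 : 0 <= T by exact: le_trans tT.
have gz : nabs (fun j => T ^+ j * q ^+ 'C(j, 2)) by exact: nabs_gauss.
rewrite /J2bound -nsumZ// -nsumZ; last exact: nabsZ.
rewrite /J2 nsum_recl; last exact: J2term_nabs.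
rewrite J2term0 [rq q n + _]addrC addrK.
apply: nsum_norm_le => [|j]; first by do 2 apply: nabsZ.
rewrite /J2term !normrM normrX (ger0_norm (qz_ge0 _)).
rewrite !(ger0_norm (rq_ge0 hq0 hq1 _)).
rewrite [leRHS](_ : _ = `|tau| * T ^+ j * (q ^+ n * q ^+ 'C(j, 2)) * K * K); last by ring.
have h1 : `|tau| ^+ j.+1 <= `|tau| * T ^+ j.
  by rewrite exprS ler_wpM2l// lerXn2r// nnegrE.
have h2 : q ^ (j.+1%:Z * (j.+1%:Z + n)) <= q ^+ n * q ^+ 'C(j, 2).
  by rewrite -exprD; apply: qz_le; have := bin2_le j; nia.
have h0 := rq_ge0 hq0 hq1; have h3 := rq_le hq0 hq1.
exact: (ler_pM4 (exprn_ge0 _ (normr_ge0 _)) (qz_ge0 _) (h0 _) (h0 _) h1 h2 (h3 _) (h3 _)).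
Qed.

Lemma J2_cvg tau : (fun n => J2 tau (Posz n)) @ \oo --> K.
Proof.
have h : (fun n => J2 tau (Posz n) - rq q n) @ \oo --> (0 : R).
  apply: (@cvg_lipschitz _ _ (fun n => q ^+ n) _ (`|tau| * J2bound `|tau|)).
    apply: nearW => n; rewrite subr0 (ger0_norm (exprn_ge0 _ (ltW hq0))) mulrAC.
    exact: J2_near.
  by apply: cvg_expr; rewrite ger0_norm ?ltW.
rewrite -[K]add0r (_ : (fun n : nat => J2 tau n) = fun n : nat => (J2 tau n - rq q n) + rq q n).
  exact: cvgD h (rq_cvg hq0 hq1).
by apply/funext => n; rewrite subrK.
Qed.

Lemma J2_tempered tau (r : int) : tempered (fun k => J2 tau (k + r)).
Proof.
suff h0 : tempered (J2 tau).
  case: r => n.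
    elim: n => [|n IHn]; first by apply: eq_tempered h0 => k; rewrite addr0.
    by apply: eq_tempered (tempered_shift IHn) => k; congr (J2 tau _); lia.
  elim: n => [|n IHn]; first by apply: eq_tempered (tempered_shiftN h0) => k; congr (J2 tau _); lia.
  by apply: eq_tempered (tempered_shiftN IHn) => k; congr (J2 tau _); lia.
have E0 := J2bound_ge0 (normr_ge0 tau).
exists (J2bound `|tau|), (1 + `|tau|); split=> //; first by rewrite lerDl.
have B1 n : 1 <= (1 + `|tau|) ^+ n by rewrite exprn_ege1// lerDl.
case=> n; first by apply: le_trans (J2_le n (lexx _)) _; rewrite ler_peMr.
rewrite NegzE J2_opp abszN normrM normrX mulrC ler_pM//; first exact: J2_le.
by rewrite lerXn2r ?nnegrE ?addr_ge0// lerDr.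
Qed.

End Bessel.

(** * The triple product and the norms *)

Section Norms.
Context {R : realType} (q t : R) (hq0 : 0 < q) (hq1 : q < 1) (ht : 0 < t).
Local Notation x := (node q t).
Local Notation w := (weight q t).
Local Notation K := (qpoch_inf q q)^-1.
Local Notation zdot := (zdot q t).
Local Notation eigen := (eigen q t).
Local Notation ladder := (ladder q t).
Implicit Types (k r : int) (n : nat).

Let q_neq0 : q != 0. Proof. by rewrite gt_eqF. Qed.
Let t_neq0 : t != 0. Proof. by rewrite gt_eqF. Qed.

Lemma weight_zabs : zabs w.
Proof.
apply: eq_zabs (tempered_zabs hq0 hq1 ht (tempered_cst 1)) => k.
by rewrite mulr1.
Qed.

Lemma rq_cvg_shift k : (fun n => rq q (Posz n + k)) @ \oo --> K.
Proof.
case: k => m.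
  rewrite (_ : (fun n : nat => _) = fun n => rq q (Posz (n + m))) //.
  by rewrite (cvg_shiftn m (fun n => rq q (Posz n))); exact: rq_cvg.
rewrite -(cvg_shiftn m.+1).
rewrite (_ : (fun n : nat => _) = fun n => rq q (Posz n)); first exact: rq_cvg.
by apply/funext => n; congr (rq q _); lia.
Qed.

(** The coefficients of the finite form of the triple product, the symmetric
    Gaussian binomials. *)
Definition cbin n k : R := qpoch q q n.*2 * rq q (Posz n + k) * rq q (Posz n - k).

Lemma cbin_rec n k : cbin n.+1 k = (1 + q ^+ n.*2.+1) * cbin n k +
  q ^ (Posz n + 1 - k) * cbin n (k - 1) + q ^ (Posz n + 1 + k) * cbin n (k + 1).
Proof.
rewrite /cbin doubleS !qpochSr.
rewrite (_ : Posz n.+1 + k = Posz n + k + 1); last by lia.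
rewrite (_ : Posz n.+1 - k = Posz n - k + 1); last by lia.
rewrite (_ : Posz n + (k + 1) = Posz n + k + 1); last by lia.
rewrite (_ : Posz n - (k - 1) = Posz n - k + 1); last by lia.
rewrite (_ : Posz n + (k - 1) = Posz n + k - 1); last by lia.
rewrite (_ : Posz n - (k + 1) = Posz n - k - 1); last by lia.
have r1 j : rq q (j - 1) = (1 - q ^ j) * rq q j.
  by have := rq_rec hq0 hq1 (j - 1); rewrite subrK.
rewrite !r1 (rq_rec hq0 hq1 (Posz n + k)) (rq_rec hq0 hq1 (Posz n - k)).
set A := rq q (Posz n + k + 1); set B := rq q (Posz n - k + 1).
have -> : Posz n + 1 - k = Posz n - k + 1 by lia.
have -> : Posz n + 1 + k = Posz n + k + 1 by lia.
rewrite !(expfzDr _ 1 q_neq0) !expr1z.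
set X := q ^ (Posz n + k); set Y := q ^ (Posz n - k).
have XY : q ^+ n.*2 = X * Y.
  by rewrite -expfzDr// -addnn exprnP; congr (q ^ _); lia.
by rewrite !exprS XY; ring.
Qed.

Lemma cbin_tempered n : tempered (cbin n).
Proof.
apply: (@tempered_bounded _ _ (`|qpoch q q n.*2| * K * K)) => k.
rewrite /cbin !normrM !(ger0_norm (rq_ge0 hq0 hq1 _)).
by rewrite !ler_pM ?mulr_ge0 ?rq_ge0// rq_le.
Qed.

(** By [cbin_rec], passing from [n] to [n + 1] multiplies the left-hand side by
    [(1 + t q^(n+1)) (1 + q^n / t)]: the shifts of [k] are absorbed by the
    weight. *)
Lemma triple_finite n :
  zsum (fun k => w k * cbin n k) = qpoch (- t * q) q n * qpoch (- t^-1) q n.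
Proof.
have h m := tempered_zabs hq0 hq1 ht (cbin_tempered m).
elim: n => [|n IHn].
  rewrite !qpoch0 mulr1 (@zsum_single _ _ 0) => [|[[|k]|k] // _].
  - have [e1 e2] : Posz 0 + 0 = 0 /\ Posz 0 - 0 = 0 by [].
    by rewrite weight0 /cbin ?e1 ?e2 !rq0 qpoch0 !mulr1.
  - by rewrite /cbin (_ : 0 - _ = Negz k) ?mulr0//; lia.
  - by rewrite /cbin (_ : 0 + _ = Negz k) ?mulr0 ?mul0r ?mulr0//; lia.
transitivity (zsum (fun k => (1 + q ^+ n.*2.+1) * (w k * cbin n k)
   + (t * q ^+ n.+1 * (w (k - 1) * cbin n (k - 1)) + q ^+ n / t * (w (k + 1) * cbin n (k + 1))))).
  apply: eq_zsum => k; rewrite cbin_rec !mulrDr -addrA.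
  have e1 : w k = t * q ^ k * w (k - 1).
    by have := weightS hq0 ht (k - 1); rewrite subrK.
  congr (_ + (_ + _)); first by ring.
    rewrite e1 -addrA expfzDr//.
    rewrite (expfzDr _ _ q_neq0) expr1z exprS -exprnP -invr_expz.
    have : q ^ k != 0 by rewrite expfz_neq0.
    by move=> ?; field.
  rewrite weightS// /node !expfzDr// !expr1z -exprnP.
  by field.
have h2 := zabsZ (t * q ^+ n.+1) (zabs_shiftN (h n)).
have h3 := zabsZ (q ^+ n / t) (zabs_shift (h n)).
rewrite zsumD; [|exact: zabsZ|exact: zabsD].
rewrite zsumD// !zsumZ; [|exact: (zabs_shift (h n))|exact: (zabs_shiftN (h n))|exact: h].
rewrite (zsum_shiftN (h n)) (zsum_shift (h n)) IHn !qpochSr -addnn exprSr exprD exprSr.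
by field.
Qed.

Definition Theta : R := zsum w.

(** The limit of the finite form, by dominated convergence. *)
Lemma triple_product : Theta =
  qpoch_inf (- t * q) q * qpoch_inf (- t^-1) q * qpoch_inf q q.
Proof.
have K0 := qfact_inf_neq0 hq0 hq1.
have rle := rq_le hq0 hq1; have rge := rq_ge0 hq0 hq1.
have h1 : (fun n => zsum (fun k => w k * cbin n k)) @ \oo --> zsum (fun k => w k * K).
  apply: (@zsum_tannery _ _ _ (fun k => w k * (K * K))).
  - by apply: tempered_zabs => //; exact: tempered_cst.
  - move=> n k; rewrite normrM ger0_norm ?weight_ge0// ler_wpM2l ?weight_ge0//.
    rewrite /cbin !normrM !(ger0_norm (rge _)) ler_pM ?mulr_ge0//.
    rewrite -[leRHS]mul1r ler_pM//.
    elim: n.*2 => [|m IHm]; first by rewrite qpoch0 normr1.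
    rewrite qpochSr normrM mulr_ile1// -exprS.
    have /andP[y0 y1] := qX01 hq0 hq1 m.+1.
    by rewrite ger0_norm ?subr_ge0// gerBl.
  - move=> k; apply: cvgMr; rewrite /cbin -[X in _ --> X]mul1r -(mulfV K0).
    rewrite -[X in _ --> X]mulrA mulrA.
    apply: cvgM; last exact: rq_cvg_shift.
    apply: cvgM; last exact: rq_cvg_shift.
    apply: (cvg_comp _ _ (_ : (fun n => n.*2) @ \oo --> \oo) (@qpoch_cvg _ _ hq0 hq1 q)).
    by move=> A [N _ hN]; exists N => // n /= Nn; apply: hN => /=; lia.
have h2 : (fun n => zsum (fun k => w k * cbin n k)) @ \oo -->
    qpoch_inf (- t * q) q * qpoch_inf (- t^-1) q.
  rewrite (funext triple_finite).
  by apply: cvgM; exact: qpoch_cvg.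
rewrite -(cvg_unique _ h1 h2)//.
rewrite (eq_zsum (g := fun k => K * w k)) => [|k]; last by rewrite mulrC.
by rewrite zsumZ; [rewrite mulrAC mulVf ?mul1r|exact: weight_zabs].
Qed.

Lemma Phi_node_eigen z : eigen z (fun k => Phi q z (x k)).
Proof. by move=> k; have := Phi_eigen hq0 hq1 z (x k); rewrite -!nodeS. Qed.

Lemma Phi_node_ladder z : ladder z (fun k => Phi q z (x k)) (fun k => Phi q (q * z) (x k)).
Proof. by move=> k; have := Phi_ladder hq0 hq1 z (x k); rewrite -!nodeS. Qed.

Lemma node_cvg0 : (fun n => x (Posz n)) @ \oo --> (0 : R).
Proof.
rewrite -(mulr0 t); apply: cvgMr.
by apply: cvg_expr; rewrite ger0_norm ?ltW.
Qed.

Lemma Phi_node_cvg z : (fun n => Phi q z (x (Posz n))) @ \oo --> (1 : R).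
Proof. exact: Phi_cvg1 node_cvg0. Qed.

Definition zM r : R := - (q ^ r / t).
Definition fS n k : R := Phi q (q ^+ n) (x k).
Definition fM r k : R := Phi q (zM r) (x k).

Lemma zMS r : zM (r + 1) = q * zM r.
Proof. by rewrite /zM expfzDr// expr1z; ring. Qed.

Lemma zM_lt0 r : zM r < 0.
Proof. by rewrite oppr_lt0 divr_gt0// exprz_gt0. Qed.

Lemma fS_eigen n : eigen (q ^+ n) (fS n). Proof. exact: Phi_node_eigen. Qed.

Lemma fS_ladder n : ladder (q ^+ n) (fS n) (fS n.+1).
Proof. by rewrite /fS exprS; exact: Phi_node_ladder. Qed.

Lemma fM_eigen r : eigen (zM r) (fM r). Proof. exact: Phi_node_eigen. Qed.

Lemma fM_ladder r : ladder (zM r) (fM r) (fM (r + 1)).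
Proof. by rewrite /fM zMS; exact: Phi_node_ladder. Qed.

Lemma fS0 k : fS 0 k = 1. Proof. by rewrite /fS expr0 Phi1. Qed.

Lemma fS_tempered n : tempered (fS n).
Proof.
elim: n => [|n IHn].
  by apply: eq_tempered (tempered_cst 1) => k; rewrite fS0.
apply: eq_tempered (fun k => esym (fS_ladder n k)) _.
apply: temperedB => //; apply: temperedM; last exact: tempered_shift.
by apply: temperedZ; apply: tempered_shift; exact: tempered_node.
Qed.

(** Both sides solve the same eigenvalue equation with the same limit as [k]
    tends to infinity; the right-hand side is the form of the solution that
    displays its moderate growth as [k] tends to minus infinity. *)
Lemma fM_J2 r k : fM r k = qpoch_inf q q * J2 q (- t * q ^ (- r)) (k + r).
Proof.
have qi := qfact_inf_neq0 hq0 hq1.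
move: k; apply: (@eigen_unique _ q t hq0 hq1 ht (zM r) _ _ 1).
- exact: fM_eigen.
- move=> k; rewrite (J2_rec hq0 hq1 _ (k + r)).
  rewrite (_ : k + 1 + r = k + r + 1); last by lia.
  rewrite (_ : k + 1 + 1 + r = k + r + 1 + 1); last by lia.
  rewrite /zM /node !(expfzDr _ _ q_neq0) !expr1z -invr_expz.
  by have : q ^ r != 0; [rewrite expfz_neq0|move=> ?; field; rewrite t_neq0].
- exact: Phi_node_cvg.
- rewrite -(mulfV qi); apply: cvgMr; set tau := - t * _.
  case: r @tau => m tau.
    rewrite (_ : (fun n : nat => _) = fun n => J2 q tau (Posz (n + m))) //.
    by rewrite (cvg_shiftn m (fun n => J2 q tau (Posz n))); exact: J2_cvg.
  rewrite -(cvg_shiftn m.+1).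
  rewrite (_ : (fun n : nat => _) = fun n => J2 q tau (Posz n)); first exact: J2_cvg.
  by apply/funext => n; congr (J2 q _ _); lia.
Qed.

Lemma fM_tempered r : tempered (fM r).
Proof.
apply: eq_tempered (fun k => esym (fM_J2 r k)) _; apply: temperedZ.
exact: J2_tempered.
Qed.

Lemma zM_inj r s : r != s -> zM r != zM s.
Proof.
move=> rs; rewrite eqr_opp; apply: contra rs => /eqP/(congr1 (fun y => y * t)).
by rewrite !divfK// => /(qz_inj hq0 hq1) ->.
Qed.

Lemma fS_orth n n' : n != n' -> zdot (fS n) (fS n') = 0.
Proof.
move=> nn'; exact: (eigen_orthogonal hq0 hq1 ht (qXn_inj hq0 hq1 nn') (fS_eigen n) (fS_eigen n')
  (fS_tempered n) (fS_tempered n')).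
Qed.

Lemma fM_orth r s : r != s -> zdot (fM r) (fM s) = 0.
Proof.
move=> rs; exact: (eigen_orthogonal hq0 hq1 ht (zM_inj rs) (fM_eigen r) (fM_eigen s)
  (fM_tempered r) (fM_tempered s)).
Qed.

Lemma fSM_orth n r : zdot (fS n) (fM r) = 0.
Proof.
have nr : q ^+ n != zM r by rewrite gt_eqF// (lt_trans (zM_lt0 r))// exprn_gt0.
exact: (eigen_orthogonal hq0 hq1 ht nr (fS_eigen n) (fM_eigen r)
  (fS_tempered n) (fM_tempered r)).
Qed.

Lemma fS_norm n : zdot (fS n) (fS n) = Theta * qpoch q q n / q ^+ n.
Proof.
elim: n => [|n IHn].
  by rewrite qpoch0 mulr1 divr1; apply: eq_zsum => k; rewrite fS0 !mulr1.
have := ladder_norm hq0 hq1 ht (fS_eigen n) (fS_ladder n) (fS_tempered n)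
  (fS_tempered n.+1) (fS_orth (_ : n != n.+1)).
rewrite IHn => /(_ _)/(congr1 (fun y => q^-1 * y)); rewrite mulKf// => ->.
  by rewrite qpochSr exprS; field; rewrite expf_neq0.
by rewrite neq_ltn ltnSn.
Qed.

Lemma fM_normS r :
  q * zdot (fM (r + 1)) (fM (r + 1)) = (1 + q ^ (r + 1) / t) * zdot (fM r) (fM r).
Proof.
rewrite (ladder_norm hq0 hq1 ht (fM_eigen r) (fM_ladder r) (fM_tempered r)
  (fM_tempered (r + 1))); last by apply: fM_orth; apply/eqP; lia.
by rewrite -zMS /zM opprK.
Qed.

Lemma binz2 k : binz k * 2 = k * (k + 1).
Proof.
case: k => n.
  elim: n => [//|n IHn].
  by rewrite -[n.+1]addn1 PoszD binzS mulrDl IHn; ring.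
rewrite NegzE; elim: n.+1 => [//|{}n IHn].
have := binzS (- n.+1%:Z); rewrite (_ : - n.+1%:Z + 1 = - n%:Z); last by lia.
by move=> h; move: IHn; rewrite h; lia.
Qed.

Lemma weightD k l : w (k + l) = w k * w l * q ^ (k * l).
Proof.
have e : binz (k + l) = binz k + binz l + k * l.
  by have := binz2 k; have := binz2 l; have := binz2 (k + l); lia.
by rewrite /weight e !expfzDr//; ring.
Qed.

Lemma J2_peak_cvg : (fun p => J2 q (- t * q ^+ p) 0) @ \oo --> (1 : R).
Proof.
apply: (@cvg_lipschitz _ _ (fun p => q ^+ p) _ (t * J2bound q t)).
  apply: nearW => p; have tau_le : `|- t * q ^+ p| <= t.
    rewrite normrM normrN (gtr0_norm ht) ger0_norm ?exprn_ge0 ?(ltW hq0)//.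
    by rewrite ler_piMr ?(ltW ht)// exprn_ile1 ?ltW.
  have := J2_near hq0 hq1 0 tau_le.
  by rewrite rq0 expr0 mulr1 normrM normrN (gtr0_norm ht) mulrAC.
by apply: cvg_expr; rewrite ger0_norm ?ltW.
Qed.

(** The eigenfunction [fM (- p)] concentrates at the node [x p]: relative to
    [w p], the square at the node [x (p + l)] contributes a multiple of
    [w l * q^(l p) * (J2 (- t q^p) l)^2], which is of order [q^p] unless
    [l = 0]. *)
Lemma fM_norm_cvg :
  (fun p : nat => zdot (fM (- p%:Z)) (fM (- p%:Z)) / w p) @ \oo --> qpoch_inf q q ^+ 2.
Proof.
pose F p l := w l * (q ^ (l * p%:Z) * J2 q (- t * q ^+ p) l ^+ 2).
have FE (p : nat) : zdot (fM (- p%:Z)) (fM (- p%:Z)) / w p = qpoch_inf q q ^+ 2 * zsum (F p).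
  have z1 := zdot_zabs hq0 hq1 ht (fM_tempered (- p%:Z)) (fM_tempered (- p%:Z)).
  have [z2 z3] := zsum_shift_nat p z1.
  have wp : w p != 0 by rewrite gt_eqF// weight_gt0.
  rewrite /zdot -z3 mulrC -zsumZ//.
  have FpE : (fun k => (w p)^-1 * (w (k + p%:Z) * (fM (- p%:Z) (k + p%:Z) * fM (- p%:Z) (k + p%:Z))))
      = (fun l => qpoch_inf q q ^+ 2 * F p l).
    apply/funext => l; rewrite !fM_J2 opprK addrK weightD /F -exprnP; field.
    by [].
  rewrite FpE zsumZ//.
  have : zabs (fun l => (qpoch_inf q q ^+ 2)^-1 * (qpoch_inf q q ^+ 2 * F p l)).
    by apply: zabsZ; rewrite -FpE; exact: zabsZ.
  by apply: eq_zabs => l; rewrite mulKf// expf_neq0// qfact_inf_neq0.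
rewrite (funext FE) -[X in _ --> X]mulr1; apply: cvgMr.
have F0 p : F p 0 = J2 q (- t * q ^+ p) 0 ^+ 2.
  by rewrite /F weight0 mul1r (_ : q ^ (0 * p%:Z) = 1) ?mul1r// mul0r.
have [E [E0 HE HN]] : exists E : R, [/\ 0 <= E,
    forall tau (n : nat), `|tau| <= t -> `|J2 q tau n| <= E &
    forall tau (n : nat), `|tau| <= t -> `|J2 q tau n - rq q n| <= `|tau| * q ^+ n * E].
  exists (J2bound q t); split; first exact: (J2bound_ge0 hq0 hq1 (ltW ht)).
    by move=> tau n; exact: J2_le.
  by move=> tau n; exact: J2_near.
have tau_le (p : nat) : `|- t * q ^+ p| <= t.
  rewrite normrM normrN (gtr0_norm ht) ger0_norm ?exprn_ge0 ?(ltW hq0)//.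
  by rewrite ler_piMr ?(ltW ht)// exprn_ile1 ?ltW.
pose G l := E ^+ 2 * (1 + t) ^+ (`|l|%N + `|l|%N).
have GT : tempered G.
  exists (E ^+ 2), ((1 + t) ^+ 2); split; rewrite ?sqr_ge0 ?exprn_ege1 ?lerDl ?(ltW ht)// => l.
  rewrite /G ger0_norm ?mulr_ge0 ?sqr_ge0 ?exprn_ge0 ?addr_ge0 ?(ltW ht)//.
  by rewrite -exprM mul2n addnn.
have FG (p : nat) (l : int) : l != 0 -> `|F p l| <= q ^+ p * (w l * G l).
  move=> l0; rewrite /F normrM (ger0_norm (weight_ge0 hq0 ht l)) [leRHS]mulrCA.
  rewrite ler_wpM2l ?weight_ge0// normrM normrX (ger0_norm (qz_ge0 hq0 _)) /G.
  have t1 : 1 <= 1 + t by rewrite lerDl ltW.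
  case: l l0 => [[//|n]|n] _.
    apply: ler_pM; rewrite ?qz_ge0 ?sqr_ge0//.
      by apply: qz_le => //; nia.
    apply: (@le_trans _ _ (E ^+ 2)).
      by rewrite lerXn2r ?nnegrE// HE.
    by rewrite ler_peMr ?sqr_ge0// exprn_ege1.
  rewrite NegzE J2_opp// normrM normrX exprMn -exprM abszN /=.
  have h1 : `|- t * q ^+ p| ^+ (n.+1 * 2) <= (1 + t) ^+ (n.+1 + n.+1) * q ^+ (p * (n.+1 + n.+1)).
    rewrite normrM normrN (gtr0_norm ht) ger0_norm ?exprn_ge0 ?(ltW hq0)//.
    rewrite exprMn -exprM addnn -muln2 ler_pM ?exprn_ge0 ?(ltW ht) ?(ltW hq0)//.
    by rewrite lerXn2r ?nnegrE ?addr_ge0 ?(ltW ht)// lerDr.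
  apply: le_trans (ler_wpM2l (qz_ge0 hq0 _) (ler_pM _ _ h1 (_ : _ <= E ^+ 2))) _.
  - by rewrite exprn_ge0.
  - by rewrite exprn_ge0.
  - by rewrite lerXn2r ?nnegrE// HE.
  rewrite [leLHS](_ : _ = q ^ (- n.+1%:Z * p) * q ^+ (p * (n.+1 + n.+1)) *
     (E ^+ 2 * (1 + t) ^+ (n.+1 + n.+1))); last by ring.
  rewrite ler_wpM2r ?mulr_ge0 ?sqr_ge0 ?exprn_ge0 ?addr_ge0 ?(ltW ht)//.
  by rewrite exprnP -expfzDr// qz_le//; nia.
have Gz : zabs (fun l => w l * G l) by exact: tempered_zabs.
have -> : (1 : R) = zsum (fun l => if l == 0 then 1 else 0).
  by rewrite (@zsum_single _ _ 0)// => l /negbTE ->.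
apply: (@zsum_tannery _ _ _ (fun l => w l * G l)) => //.
  move=> p l; have [->|l0] := eqVneq l 0.
    rewrite F0 weight0 mul1r /G /= mulr1 normrX.
    by rewrite lerXn2r ?nnegrE// (HE _ 0%N).
  apply: le_trans (FG p l l0) _.
  rewrite ler_piMl ?exprn_ile1 ?(ltW hq0) ?(ltW hq1)// mulr_ge0 ?weight_ge0//.
  by rewrite mulr_ge0 ?sqr_ge0 ?exprn_ge0 ?addr_ge0 ?(ltW ht).
have qc : (fun p => q ^+ p) @ \oo --> (0 : R).
  by apply: cvg_expr; rewrite ger0_norm ?ltW.
move=> l; have [->|l0] := eqVneq l 0; last first.
  apply: (@cvg_lipschitz _ _ (fun p => q ^+ p) _ (w l * G l)) => //.
  apply: nearW => p; rewrite subr0 mulrC (ger0_norm (exprn_ge0 _ (ltW hq0))).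
  exact: FG.
rewrite (_ : (fun n : nat => _) = fun p => J2 q (- t * q ^+ p) 0 ^+ 2); last first.
  by apply/funext => p; exact: F0.
have -> : (1 : R) = 1 ^+ 2 by rewrite expr1n.
by apply: cvgM; exact: J2_peak_cvg.
Qed.

Lemma fM_peak_cvg : (fun p : nat => fM (- p%:Z) p) @ \oo --> qpoch_inf q q.
Proof.
rewrite (_ : (fun p : nat => _) = fun p => qpoch_inf q q * J2 q (- t * q ^+ p) 0).
  by rewrite -[X in _ --> X]mulr1; apply: cvgMr; exact: J2_peak_cvg.
by apply/funext => p; rewrite fM_J2 opprK subrr -exprnP.
Qed.

Lemma fM_norm_neg (p : nat) : zdot (fM (- p%:Z)) (fM (- p%:Z)) =
  zdot (fM 0) (fM 0) * w p / qpoch (- t) q p.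
Proof.
elim: p => [|p IHp]; first by rewrite oppr0 weight0 qpoch0 mulr1 divr1.
have := fM_normS (- p.+1%:Z); rewrite (_ : - p.+1%:Z + 1 = - p%:Z); last by lia.
rewrite IHp -invr_expz -exprnP qpochSr -[in w p.+1]addn1 PoszD weightS//.
rewrite /node (expfzDr _ _ q_neq0) expr1z -exprnP.
have qp : q ^+ p != 0 by rewrite expf_neq0.
have h1 : qpoch (- t) q p != 0.
  by rewrite gt_eqF// (lt_le_trans ltr01)// qpoch_ge1// oppr_le0 ltW.
have h2 : 1 - - t * q ^+ p != 0.
  by rewrite mulNr opprK gt_eqF// addr_gt0// mulr_gt0// exprn_gt0.
have h3 : 1 + (q ^+ p)^-1 / t != 0.
  by rewrite gt_eqF// addr_gt0// divr_gt0// invr_gt0 exprn_gt0.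
move=> h; apply: (mulfI h3); rewrite -h; field.
by rewrite h1 qp t_neq0; move: h2; rewrite mulNr opprK => ->.
Qed.

(** The ladder fixes the norm of [fM (- p)] relative to that of [fM 0], and the
    concentration of [fM (- p)] fixes its asymptotics. *)
Lemma fM_norm0 : zdot (fM 0) (fM 0) = qpoch_inf q q ^+ 2 * qpoch_inf (- t) q.
Proof.
have t0 : - t <= 0 by rewrite oppr_le0 ltW.
have ti := qpoch_inf_neq0 hq0 hq1 t0.
have h : (fun p : nat => zdot (fM (- p%:Z)) (fM (- p%:Z)) / w p) @ \oo -->
    zdot (fM 0) (fM 0) / qpoch_inf (- t) q.
  rewrite (_ : (fun p : nat => _) = fun p => zdot (fM 0) (fM 0) / qpoch (- t) q p).
    by apply: cvgMr; apply: cvgV => //; exact: qpoch_cvg.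
  by apply/funext => p; rewrite fM_norm_neg mulrAC mulfK// gt_eqF// weight_gt0.
by rewrite (cvg_unique _ fM_norm_cvg h)// divfK.
Qed.

Lemma fM_norm r : zdot (fM r) (fM r) =
  qpoch_inf q q ^+ 2 * qpoch_inf (- t) q * qpochz (- (q / t)) q r / q ^ r.
Proof.
have a0 : - (q / t) <= 0 by rewrite oppr_le0 divr_ge0 ?ltW.
pose Q r := zdot (fM r) (fM r) * q ^ r / qpochz (- (q / t)) q r.
have QS s : Q (s + 1) = Q s.
  have nz := qpochz_neq0 hq0 hq1 s a0; have qs : q ^ s != 0 by rewrite expfz_neq0.
  have h2 : 1 - - (q / t) * q ^ s != 0.
    by rewrite mulNr opprK gt_eqF// addr_gt0// mulr_gt0 ?divr_gt0// exprz_gt0.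
  rewrite /Q qpochzS// expfzDr// expr1z.
  rewrite (_ : zdot _ _ * (q ^ s * q) = (q * zdot (fM (s + 1)) (fM (s + 1))) * q ^ s); last by ring.
  rewrite fM_normS expfzDr// expr1z; field.
  rewrite nz t_neq0 /=; apply: contra h2 => /eqP h; apply/eqP.
  by apply: (mulIf t_neq0); rewrite mul0r -[RHS]h; field.
have Q0 : Q r = Q 0.
  case: r => n; first by elim: n => // n IHn; rewrite -[n.+1]addn1 PoszD QS.
  rewrite NegzE; elim: n.+1 => [|{}n IHn]; first by rewrite oppr0.
  by rewrite -IHn -QS; congr Q; lia.
move: Q0; rewrite /Q fM_norm0 expr0z mulr1 qpochz0// divr1 => <-.
by field; rewrite qpochz_neq0// expfz_neq0.
Qed.

Lemma fM_norm_gt0 r : 0 < zdot (fM r) (fM r).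
Proof.
have h1 : 0 < qpoch_inf (- t) q.
  by apply: lt_le_trans ltr01 _; apply: qpoch_inf_ge1; rewrite // oppr_le0 ltW.
have h2 : 0 < qpochz (- (q / t)) q r.
  by apply: qpochz_gt0; rewrite // oppr_le0 divr_ge0 ?ltW.
have h3 := qfact_inf_gt0 hq0 hq1.
rewrite fM_norm; apply: divr_gt0; last exact: exprz_gt0.
by apply: mulr_gt0 => //; apply: mulr_gt0 => //; exact: exprn_gt0.
Qed.

Lemma Theta_gt0 : 0 < Theta.
Proof.
apply: lt_le_trans (weight_gt0 hq0 ht 0) _.
by apply: le_zsum_term; [exact: weight_zabs|move=> k; exact: weight_ge0].
Qed.

Lemma fS_norm_gt0 n : 0 < zdot (fS n) (fS n).
Proof. by rewrite fS_norm divr_gt0 ?exprn_gt0// mulr_gt0 ?Theta_gt0// qfact_gt0. Qed.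

End Norms.

(** * Completeness *)

Section Completeness.
Context {R : realType} (q t : R) (hq0 : 0 < q) (hq1 : q < 1) (ht : 0 < t).
Local Notation x := (node q t).
Local Notation w := (weight q t).
Local Notation zdot := (zdot q t).
Local Notation eigen := (eigen q t).
Local Notation ladder := (ladder q t).
Local Notation fS := (fS q t).
Local Notation fM := (fM q t).
Local Notation zM := (zM q t).
Local Notation Theta := (Theta q t).
Implicit Types (k l r : int) (n N : nat) (i : nat + int) (f g : int -> R).

Let q_neq0 : q != 0. Proof. by rewrite gt_eqF. Qed.
Let t_neq0 : t != 0. Proof. by rewrite gt_eqF. Qed.

Definition fSM i : int -> R := match i with inl n => fS n | inr r => fM r end.

Definition sqnorm i : R := zdot (fSM i) (fSM i).

Lemma fSM_tempered i : tempered (fSM i).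
Proof. by case: i => [n|r]; [exact: fS_tempered|exact: fM_tempered]. Qed.

Lemma sqnorm_gt0 i : 0 < sqnorm i.
Proof. by case: i => [n|r]; [exact: fS_norm_gt0|exact: fM_norm_gt0]. Qed.

Lemma sqnorm_neq0 i : sqnorm i != 0.
Proof. by rewrite gt_eqF ?sqnorm_gt0. Qed.

Lemma fSM_orthogonal i (j : nat + int) : i != j -> zdot (fSM i) (fSM j) = 0.
Proof.
case: i j => [n|r] [n'|r'] ij /=.
- exact: fS_orth.
- exact: fSM_orth.
- by rewrite zdotC; exact: fSM_orth.
- exact: fM_orth.
Qed.

Lemma zdotDl f g h : tempered f -> tempered g -> tempered h ->
  zdot (fun k => f k + g k) h = zdot f h + zdot g h.
Proof.
move=> fT gT hT; rewrite /zdot -zsumD; [|exact: zdot_zabs|exact: zdot_zabs].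
by apply: eq_zsum => k; ring.
Qed.

Lemma zdotZl c f g : tempered f -> tempered g ->
  zdot (fun k => c * f k) g = c * zdot f g.
Proof.
move=> fT gT; rewrite /zdot -zsumZ; last exact: zdot_zabs.
by apply: eq_zsum => k; ring.
Qed.

Lemma wsqr_ge0 k (a : R) : 0 <= w k * a ^+ 2.
Proof. by apply: mulr_ge0; [exact: weight_ge0|exact: sqr_ge0]. Qed.

Lemma zdot_ge0 f : tempered f -> 0 <= zdot f f.
Proof.
move=> fT; apply: zsum_ge0; first exact: zdot_zabs.
by move=> k; exact: wsqr_ge0.
Qed.

Definition fcoef f i : R := zdot f (fSM i) / sqnorm i.

Definition residual (s : seq (nat + int)) f k : R :=
  f k - \sum_(i <- s) fcoef f i * fSM i k.

Lemma residual_cons i s f k :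
  residual (i :: s) f k = residual s f k + - fcoef f i * fSM i k.
Proof. by rewrite /residual big_cons; ring. Qed.

Lemma residual_tempered s f : tempered f -> tempered (residual s f).
Proof.
move=> fT; elim: s => [|i s IHs].
  by apply: eq_tempered fT => k; rewrite /residual big_nil subr0.
apply: eq_tempered (fun k => esym (residual_cons i s f k)) _.
by apply: temperedD => //; apply: temperedZ; exact: fSM_tempered.
Qed.

Lemma residual_orthogonal s f i : tempered f -> i \notin s ->
  zdot (residual s f) (fSM i) = zdot f (fSM i).
Proof.
move=> fT; elim: s => [|j s IHs].
  by move=> _; apply: eq_zsum => k; rewrite /residual big_nil subr0.
rewrite inE negb_or => /andP[ij /IHs <-].
rewrite [LHS](_ : _ = zdot (fun k => residual s f k + - fcoef f j * fSM j k) (fSM i)); last first.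
  by apply: eq_zsum => k; rewrite residual_cons.
rewrite zdotDl ?zdotZl ?fSM_orthogonal 1?eq_sym// ?mulr0 ?addr0//.
- exact: fSM_tempered.
- exact: fSM_tempered.
- exact: residual_tempered.
- by apply: temperedZ; exact: fSM_tempered.
- exact: fSM_tempered.
Qed.

(** Pythagoras, one basis function at a time. *)
Lemma residual_norm s f : tempered f -> uniq s ->
  zdot (residual s f) (residual s f) =
  zdot f f - \sum_(i <- s) zdot f (fSM i) ^+ 2 / sqnorm i.
Proof.
move=> fT; elim: s => [|i s IHs].
  by move=> _; rewrite big_nil subr0; apply: eq_zsum => k; rewrite /residual big_nil subr0.
rewrite cons_uniq => /andP[si us]; rewrite big_cons opprD addrCA -IHs//.
have rT := residual_tempered s fT; have eT := fSM_tempered i.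
have cT := temperedZ (- fcoef f i) eT.
rewrite [LHS](_ : _ = zdot (fun k => residual s f k + - fcoef f i * fSM i k)
   (fun k => residual s f k + - fcoef f i * fSM i k)); last first.
  by apply: eq_zsum => k; rewrite !residual_cons.
rewrite zdotDl//; last exact: temperedD.
rewrite zdotZl//; last exact: temperedD.
rewrite (zdotC _ _ (residual s f)) (zdotC _ _ (fSM i)) (zdotDl rT cT rT) (zdotDl rT cT eT) (zdotZl _ eT rT) (zdotZl _ eT eT).
rewrite (zdotC _ _ (fSM i)) residual_orthogonal// -/(sqnorm i) /fcoef.
by field; exact: sqnorm_neq0.
Qed.

Definition kron k0 k : R := (k == k0)%:R.

Lemma kron_tempered k0 : tempered (kron k0).
Proof.
by apply: (@tempered_bounded _ _ 1) => k; rewrite /kron; case: eqP; rewrite ?normr1 ?normr0.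
Qed.

Lemma zdot_kron k0 f : zdot (kron k0) f = w k0 * f k0.
Proof.
rewrite /zdot (@zsum_single _ _ k0) /kron ?eqxx ?mul1r// => k /negbTE ->.
by rewrite mul0r mulr0.
Qed.

(** The increasing exhaustion of the index set along which all sums over it
    are taken. *)
Definition iwin N : seq (nat + int) :=
  [seq inl n | n <- iota 0 N] ++
  ([seq inr (Posz n) | n <- iota 0 N] ++ [seq inr (Negz n) | n <- iota 0 N]).

Lemma iwin_uniq N : uniq (iwin N).
Proof.
rewrite !cat_uniq !map_inj_uniq ?iota_uniq //=; try by move=> a b [].
rewrite andbT; apply/andP; split; apply/hasPn => i.
  by rewrite mem_cat => /orP[] /mapP[n _ ->]; apply/mapP => -[].
by move=> /mapP[n _ ->]; apply/mapP => -[].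
Qed.

Lemma sum_iwin (F : nat + int -> R) N :
  \sum_(i <- iwin N) F i = \sum_(n < N) F (inl (n : nat)) + zwin (fun r => F (inr r)) N.
Proof.
rewrite /iwin !big_cat !big_map /zwin big_split /=.
rewrite -(big_mkord xpredT (fun n => F (inl n))) -(big_mkord xpredT (fun n => F (inr (Posz n)))).
by rewrite -(big_mkord xpredT (fun n => F (inr (Negz n)))) /index_iota subn0.
Qed.

Definition kterm k l i : R := fSM i k * fSM i l / sqnorm i.

Lemma kterm_ge0 k i : 0 <= kterm k k i.
Proof. by rewrite /kterm -expr2 divr_ge0 ?sqr_ge0// ltW ?sqnorm_gt0. Qed.

Lemma residual_kron_norm s k : uniq s ->
  zdot (residual s (kron k)) (residual s (kron k)) =
  w k - w k ^+ 2 * \sum_(i <- s) kterm k k i.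
Proof.
move=> us; rewrite residual_norm//; last exact: kron_tempered.
rewrite zdot_kron /kron eqxx mulr1 mulr_sumr; congr (_ - _).
by apply: eq_bigr => i _; rewrite zdot_kron /kterm exprMn; ring.
Qed.

Lemma bessel_inequality s k : uniq s -> \sum_(i <- s) kterm k k i <= (w k)^-1.
Proof.
move=> us; have w0 := weight_gt0 hq0 ht k.
have := zdot_ge0 (residual_tempered s (kron_tempered k)).
rewrite residual_kron_norm// subr_ge0 expr2 -mulrA ger_pMr// => h.
by rewrite -[leRHS]mulr1 ler_pdivlMl.
Qed.

Lemma kterm_diag_summable k :
  nabs (fun n => kterm k k (inl n)) /\ zabs (fun r => kterm k k (inr r)).
Proof.
have h N : \sum_(n < N) kterm k k (inl (n : nat)) + zwin (fun r => kterm k k (inr r)) N <= (w k)^-1.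
  by rewrite -sum_iwin; apply: bessel_inequality; exact: iwin_uniq.
split; exists (w k)^-1 => N; apply: le_trans (h N).
  under eq_bigr do rewrite ger0_norm ?kterm_ge0//.
  by rewrite lerDl sumr_ge0// => n _; rewrite addr_ge0 ?kterm_ge0.
rewrite (@eq_zwin _ _ (fun r => kterm k k (inr r))) => [|r]; last by rewrite ger0_norm ?kterm_ge0.
by rewrite lerDr sumr_ge0// => n _; exact: kterm_ge0.
Qed.

Lemma kterm_le k l i : `|kterm k l i| <= kterm k k i + kterm l l i.
Proof.
rewrite /kterm normrM normfV (gtr0_norm (sqnorm_gt0 i)) -mulrDl.
rewrite ler_pM2r ?invr_gt0 ?sqnorm_gt0// normrM -!expr2.
rewrite -(real_normK (num_real (fSM i k))) -(real_normK (num_real (fSM i l))).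
have h (a b : R) : 0 <= a -> 0 <= b -> a * b <= a ^+ 2 + b ^+ 2.
  by move=> a0 b0; have := sqr_ge0 (a - b); nra.
exact: h.
Qed.

Lemma ktermS_summable k l : nabs (fun n => kterm k l (inl n)).
Proof.
have h1 := (kterm_diag_summable k).1; have h2 := (kterm_diag_summable l).1.
apply: le_nabs (nabsD h1 h2) _ => n.
by apply: le_trans (kterm_le _ _ _) (ler_norm _).
Qed.

Lemma ktermM_summable k l : zabs (fun r => kterm k l (inr r)).
Proof.
have h1 := (kterm_diag_summable k).2; have h2 := (kterm_diag_summable l).2.
apply: le_zabs (zabsD h1 h2) _ => r.
by apply: le_trans (kterm_le _ _ _) (ler_norm _).
Qed.

(** The reproducing kernel of the closed span; completeness says that it is
    diagonal with entries [1 / w k]. *)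
Definition span_kernel k l : R :=
  nsum (fun n => kterm k l (inl n)) + zsum (fun r => kterm k l (inr r)).

Lemma span_kernel_cvg k l :
  (fun N => \sum_(i <- iwin N) kterm k l i) @ \oo --> span_kernel k l.
Proof.
under eq_fun do rewrite sum_iwin.
apply: cvgD; last exact/zabs_cvg/ktermM_summable.
rewrite (_ : (fun N => _) = series (fun n => kterm k l (inl n))).
  exact/nsum_cvg/ktermS_summable.
by apply/funext => N; rewrite /series /= big_mkord.
Qed.

Definition dualW (z : R) f k l : R :=
  (x k * f (k + 1) * f l - x l * f k * f (l + 1)) / z.

(** Summation by parts in the spectral variable: multiplication by the
    position acts on the eigenfunctions as a three-term recurrence. *)
Lemma dual_step z f g nf ng k l : z != 0 -> nf != 0 -> ng != 0 ->
  eigen z f -> ladder z f g -> q * ng = (1 - q * z) * nf ->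
  (x k - x l) * (g k * g l / ng) = dualW (q * z) g k l / ng - dualW z f k l / nf.
Proof.
move=> z0 nf0 ng0 fz fg hn; rewrite /dualW.
have nfE : nf^-1 = (1 - q * z) / (q * ng).
  by rewrite hn invfM mulrA mulfV ?mul1r// -(mulIr_eq0 _ (mulIf nf0)) -hn mulf_neq0.
rewrite nfE.
have h1 : (1 - q * z) * f (k + 1) = g (k + 1) - q * z * g k by exact: ladder_down.
have h2 : (1 - q * z) * f (l + 1) = g (l + 1) - q * z * g l by exact: ladder_down.
have h3 : f k = g k + z * (q * x k) * f (k + 1) by rewrite fg nodeS// subrK.
have h4 : f l = g l + z * (q * x l) * f (l + 1) by rewrite fg nodeS// subrK.
rewrite [X in _ = _ - X](_ : _ = (x k * ((1 - q * z) * f (k + 1)) * f l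
     - x l * f k * ((1 - q * z) * f (l + 1))) / (q * z * ng)); last first.
  by field; rewrite z0 q_neq0 ng0.
have -> : x k * ((1 - q * z) * f (k + 1)) * f l - x l * f k * ((1 - q * z) * f (l + 1))
   = x k * ((1 - q * z) * f (k + 1)) * g l - x l * g k * ((1 - q * z) * f (l + 1)).
  by rewrite h3 h4; ring.
by rewrite h1 h2; field; rewrite z0 q_neq0 ng0.
Qed.

Lemma sqnormS n : q * sqnorm (inl n.+1) = (1 - q * q ^+ n) * sqnorm (inl n).
Proof.
rewrite /sqnorm /= !fS_norm// qpochSr exprS; field.
by rewrite q_neq0 expf_neq0.
Qed.

Lemma sqnormM r : q * sqnorm (inr (r + 1)) = (1 - q * zM r) * sqnorm (inr r).
Proof. by rewrite /sqnorm /= fM_normS// -zMS// /zM opprK. Qed.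

Definition VS k l n := dualW (q ^+ n) (fS n) k l / sqnorm (inl n).
Definition VM k l r := dualW (zM r) (fM r) k l / sqnorm (inr r).

Lemma zM_neq0 r : zM r != 0. Proof. by rewrite lt_eqF// zM_lt0. Qed.

Lemma ktermS_telescope k l N :
  (x k - x l) * \sum_(n < N.+1) kterm k l (inl (n : nat)) = VS k l N.
Proof.
elim: N => [|N IHN].
  by rewrite big_ord1 /VS /dualW /kterm /= !fS0 expr0 !mulr1 divr1 mulrC mulrAC mul1r mulrC.
rewrite big_ord_recr /= mulrDr IHN /kterm /=.
rewrite (dual_step k l _ _ _ (@fS_eigen _ _ t hq0 hq1 N) (@fS_ladder _ _ t hq0 hq1 N) (sqnormS N)).
- by rewrite /VS exprS addrC subrK.
- by rewrite expf_neq0.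
- exact: sqnorm_neq0.
- exact: sqnorm_neq0.
Qed.

Lemma ktermM_telescope k l N :
  (x k - x l) * zwin (fun r => kterm k l (inr r)) N = VM k l (Posz N - 1) - VM k l (- Posz N - 1).
Proof.
rewrite -zwinZ -(zwin_telescope (fun r => VM k l (r - 1))).
apply: eq_zwin => r; rewrite addrK.
have := dual_step k l (zM_neq0 (r - 1)) (sqnorm_neq0 (inr (r - 1)))
  (sqnorm_neq0 (inr (r - 1 + 1))) (@fM_eigen _ _ t hq0 hq1 (r - 1))
  (@fM_ladder _ _ t hq0 hq1 (r - 1)) (sqnormM (r - 1)).
by rewrite -zMS// subrK.
Qed.

Lemma cvg_dualW_num (F : nat -> int -> R) (G : int -> R) k l :
  (forall j : int, (fun n => F n j) @ \oo --> G j) ->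
  (fun n => x k * F n (k + 1) * F n l - x l * F n k * F n (l + 1)) @ \oo -->
  x k * G (k + 1) * G l - x l * G k * G (l + 1).
Proof.
by move=> FG; apply: cvgB; (apply: cvgM; [apply: cvgM; [exact: cvg_cst|exact: FG]|exact: FG]).
Qed.

Lemma VS_cvg k l : VS k l @ \oo -->
  (x k * Phi q 0 (x (k + 1)) * Phi q 0 (x l) - x l * Phi q 0 (x k) * Phi q 0 (x (l + 1)))
  / (Theta * qpoch_inf q q).
Proof.
have th0 : Theta != 0 by rewrite gt_eqF ?Theta_gt0.
rewrite (_ : VS k l = fun n => (x k * fS n (k + 1) * fS n l - x l * fS n k * fS n (l + 1))
    / (Theta * qpoch q q n)); last first.
  apply/funext => n; rewrite /VS /dualW /sqnorm /= fS_norm//; field.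
  by rewrite th0 qfact_neq0// expf_neq0.
have qc : (fun n => q ^+ n) @ \oo --> (0 : R) by apply: cvg_expr; rewrite ger0_norm ?ltW.
have fc (j : int) : (fun n => fS n j) @ \oo --> Phi q 0 (x j) by exact: Phi_cvg0.
apply: cvgM.
  have hd := @cvg_dualW_num _ _ k l fc.
  exact: hd.
apply: cvgV; first by rewrite mulf_neq0 ?qfact_inf_neq0.
by apply: cvgMr; exact: qpoch_cvg.
Qed.

Lemma VM_cvg k l : (fun N : nat => VM k l N) @ \oo -->
  - ((x k * Phi q 0 (x (k + 1)) * Phi q 0 (x l) - x l * Phi q 0 (x k) * Phi q 0 (x (l + 1)))
  / (Theta * qpoch_inf q q)).
Proof.
have a0 : - (q / t) <= 0 by rewrite oppr_le0 divr_ge0 ?ltW.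
have t0 : - t <= 0 by rewrite oppr_le0 ltW.
have qi := qfact_inf_neq0 hq0 hq1.
have qt := qpoch_inf_neq0 hq0 hq1 t0; have qa := qpoch_inf_neq0 hq0 hq1 a0.
pose D := qpoch_inf q q ^+ 2 * qpoch_inf (- t) q / t.
have D0 : D != 0 by rewrite mulf_neq0 ?invr_neq0// mulf_neq0 ?expf_neq0.
(* The two one-sided limits at the spectral point 0 agree up to sign; this is
   where the triple product enters. *)
have ThD : Theta * qpoch_inf q q = D * qpoch_inf (- (q / t)) q.
  rewrite triple_product// /D (qpoch_infS hq0 hq1 (- t)) (qpoch_infS hq0 hq1 (- t^-1)).
  rewrite (_ : - t^-1 * q = - (q / t)); last by ring.
  by field.
rewrite (_ : (fun N : nat => _) = fun n => - ((x k * fM n (k + 1) * fM n l - x l * fM n k * fM n (l + 1))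
    / (D * qpoch (- (q / t)) q n))); last first.
  apply/funext => n; rewrite /VM /dualW /sqnorm /= fM_norm// qpochz_nat// /zM /D -!exprnP.
  have qn : q ^+ n != 0 by rewrite expf_neq0.
  have h : qpoch (- (q / t)) q n != 0.
    by rewrite gt_eqF// (lt_le_trans ltr01)// qpoch_ge1.
  by field; rewrite t_neq0 qi qt qn h.
have zc : (fun n : nat => zM n) @ \oo --> (0 : R).
  rewrite -oppr0 -(mul0r t^-1); apply: cvgN; apply: cvgMl.
  by apply: cvg_expr; rewrite ger0_norm ?ltW.
have fc (j : int) : (fun n : nat => fM n j) @ \oo --> Phi q 0 (x j) by exact: Phi_cvg0.
rewrite ThD; apply: cvgN; apply: cvgM.
  have hd := @cvg_dualW_num _ _ k l fc.
  exact: hd.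
apply: cvgV; first by rewrite mulf_neq0.
by apply: cvgMr; exact: qpoch_cvg.
Qed.

(** As [r] tends to minus infinity the eigenvalue [- q^r / t] tends to minus
    infinity, while the products of eigenfunctions divided by the squared norm
    tend to [0] by summability. *)
Lemma VM_cvg0 k l : (fun N : nat => VM k l (- Posz N - 1)) @ \oo --> (0 : R).
Proof.
have h1 := zabs_opp_cvg0 (zabs_shiftN (ktermM_summable (k + 1) l)).
have h2 := zabs_opp_cvg0 (zabs_shiftN (ktermM_summable k (l + 1))).
rewrite (_ : (fun N : nat => _) = fun N => (x k * kterm (k + 1) l (inr (- Posz N - 1))
    - x l * kterm k (l + 1) (inr (- Posz N - 1))) * (- (t * q) * q ^+ N)); last first.
  apply/funext => N; rewrite /VM /dualW /kterm /= /zM expfzDr// -invr_expz -exprnP.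
  rewrite (_ : q ^ (-1) = q^-1); last by rewrite exprN1.
  field; rewrite q_neq0 t_neq0 expf_neq0//=.
  by rewrite sqnorm_neq0.
have qc : (fun n => - (t * q) * q ^+ n) @ \oo --> - (t * q) * (0 : R).
  by apply: cvgMr; apply: cvg_expr; rewrite ger0_norm ?ltW.
rewrite mulr0 in qc; rewrite -(mulr0 (x k * 0 - x l * 0)); apply: cvgM => //.
by apply: cvgB; apply: cvgMr.
Qed.

Lemma span_kernel_offdiag k l : k != l -> span_kernel k l = 0.
Proof.
move=> kl; have xkl : x k - x l != 0.
  rewrite subr_eq0; apply: contra kl => /eqP/(mulfI t_neq0) h; apply/eqP.
  exact: (qz_inj hq0 hq1 h).
apply: (mulfI xkl); rewrite mulr0.
have h1 : (fun N => (x k - x l) * \sum_(i <- iwin N) kterm k l i) @ \oo --> (x k - x l) * span_kernel k l.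
  by apply: cvgMr; exact: span_kernel_cvg.
rewrite -cvg_shiftS /= in h1.
have h2 : (fun N => (x k - x l) * \sum_(i <- iwin N.+1) kterm k l i) @ \oo --> (0 : R).
  rewrite (_ : (fun N : nat => _) = fun N : nat => VS k l N + (VM k l N - VM k l (- Posz N.+1 - 1))); last first.
    apply/funext => N; rewrite sum_iwin mulrDr ktermS_telescope ktermM_telescope.
    by rewrite (_ : Posz N.+1 - 1 = N)//; lia.
  have hVS := @VS_cvg k l; have hVM := @VM_cvg k l.
  have hVM0 : (fun N : nat => VM k l (- Posz N.+1 - 1)) @ \oo --> (0 : R).
    by rewrite (cvg_shiftS (fun N : nat => VM k l (- Posz N - 1))); exact: VM_cvg0.
  move: hVS hVM; set L := _ / _ => hVS hVM.
  suff : (fun N : nat => VS k l N + (VM k l N - VM k l (- Posz N.+1 - 1))) @ \oo --> L + (- L - 0).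
    by rewrite subr0 subrr.
  by apply: cvgD hVS _; exact: cvgB.
exact: (cvg_unique _ h1 h2).
Qed.

(** Both sides equal [q * x (k + 1) * f (k + 1 + 1) * g (k + 1) / nf], by the
    ladder relations. *)
Lemma diag_step z f g nf ng k : nf != 0 -> ng != 0 ->
  eigen z f -> ladder z f g -> q * ng = (1 - q * z) * nf ->
  g (k + 1) * g (k + 1) / ng - g (k + 1) * g k / ng =
  x (k + 1 + 1) * (f (k + 1 + 1) * f (k + 1 + 1) / nf
     - x (k + 1 + 1) * (f (k + 1 + 1 + 1) * f (k + 1 + 1) / nf)).
Proof.
move=> nf0 ng0 fz fg hn.
rewrite -mulrBl -mulrBr (ladder_diff hq0 k fz fg).
have e : (1 - q * z) / ng = q / nf.
  by apply: (mulIf ng0); rewrite divfK// mulrAC hn mulfK.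
transitivity (g (k + 1) * (x (k + 1) * f (k + 1 + 1)) * ((1 - q * z) / ng)).
  by field.
rewrite e (ladder_up (k + 1) fz fg) (nodeS _ _ (k + 1))//.
by field.
Qed.

(** The entries off the diagonal vanish, so the ladder relations turn into a
    recurrence for the diagonal. *)
Lemma span_kernel_diagS k : span_kernel (k + 1) (k + 1) = x (k + 1 + 1) * span_kernel (k + 1 + 1) (k + 1 + 1).
Proof.
suff : span_kernel (k + 1) (k + 1) - span_kernel (k + 1) k = x (k + 1 + 1) *
    (span_kernel (k + 1 + 1) (k + 1 + 1) - x (k + 1 + 1) * span_kernel (k + 1 + 1 + 1) (k + 1 + 1)).
  rewrite (@span_kernel_offdiag (k + 1) k); last by lia.
  rewrite (@span_kernel_offdiag (k + 1 + 1 + 1) (k + 1 + 1)); last by lia.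
  by rewrite mulr0 !subr0.
have hS := ktermS_summable; have hM := ktermM_summable.
rewrite /span_kernel opprD addrACA -nsumB// -zsumB//.
have -> a b c d e : x e * (a + b - x e * (c + d)) = x e * (a - x e * c) + x e * (b - x e * d) by ring.
rewrite -!nsumZ// -!zsumZ// -nsumB//; last exact: nabsZ.
rewrite -zsumB//; last exact: zabsZ.
rewrite -nsumZ; last by apply: nabsB => //; exact: nabsZ.
rewrite -zsumZ; last by apply: zabsB => //; exact: zabsZ.
congr (_ + _).
  rewrite nsum_recl; last exact: nabsB.
  rewrite /kterm /= !fS0 subrr add0r; apply: eq_nsum => n.
  exact: (diag_step k (sqnorm_neq0 (inl n)) (sqnorm_neq0 (inl n.+1))
    (@fS_eigen _ _ t hq0 hq1 n) (@fS_ladder _ _ t hq0 hq1 n) (sqnormS n)).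
rewrite -zsum_shift; last exact: zabsB.
apply: eq_zsum => r; rewrite /kterm /=.
exact: (diag_step k (sqnorm_neq0 (inr r)) (sqnorm_neq0 (inr (r + 1)))
    (@fM_eigen _ _ t hq0 hq1 r) (@fM_ladder _ _ t hq0 hq1 r) (sqnormM r)).
Qed.

Lemma span_kernel_diag_const k : w k * span_kernel k k = w 0 * span_kernel 0 0.
Proof.
have h (j : int) : w (j + 1) * span_kernel (j + 1) (j + 1) = w j * span_kernel j j.
  have := span_kernel_diagS (j - 1); rewrite subrK => ->.
  by rewrite weightS//; ring.
case: k => n; first by elim: n => // n IHn; rewrite -[n.+1]addn1 PoszD h.
rewrite NegzE; elim: n.+1 => [|{}n IHn]; first by rewrite oppr0.
by rewrite -IHn -h; rewrite (_ : - n.+1%:Z + 1 = - n%:Z)//; lia.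
Qed.

(** The constant is at most [1] by Bessel's inequality, and at least [1]
    because of the eigenfunctions that concentrate at a single node. *)
Lemma span_kernel_diag k : span_kernel k k = (w k)^-1.
Proof.
have wn0 (j : int) : w j != 0 by rewrite gt_eqF ?weight_gt0.
suff c1 : w 0 * span_kernel 0 0 = 1.
  by apply: (mulfI (wn0 k)); rewrite span_kernel_diag_const c1 mulfV.
apply/le_anti/andP; split.
  rewrite -(mulfV (wn0 0)) ler_wpM2l ?weight_ge0//.
  rewrite -(cvg_lim _ (@span_kernel_cvg 0 0))//; apply: limr_le.
    by apply/cvg_ex; eexists; exact: span_kernel_cvg.
  by apply: nearW => N; apply: bessel_inequality; exact: iwin_uniq.
have qi := qfact_inf_neq0 hq0 hq1.
have h : (fun p : nat => fM (- p%:Z) p ^+ 2 / (zdot (fM (- p%:Z)) (fM (- p%:Z)) / w p)) @ \oo --> (1 : R).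
  rewrite -(mulfV (expf_neq0 2 qi)); apply: cvgM; last first.
    by apply: cvgV; [rewrite expf_neq0|exact: fM_norm_cvg].
  by apply: cvgM; exact: fM_peak_cvg.
rewrite -(cvg_lim _ h)//; apply: limr_le; first by apply/cvg_ex; eexists; exact: h.
apply: nearW => p; rewrite -(span_kernel_diag_const p).
rewrite (_ : _ / _ = w p * kterm p p (inr (- p%:Z))); last first.
  rewrite /kterm /= -/(sqnorm (inr (- p%:Z))).
  by have := sqnorm_neq0 (inr (- p%:Z)); have := wn0 p => *; field; apply/andP.
rewrite ler_wpM2l ?weight_ge0//.
apply: le_trans (le_zsum_term (- p%:Z) (ktermM_summable p p) (fun r => kterm_ge0 p (inr r))) _.
rewrite /span_kernel lerDr.
apply: le_trans (normr_ge0 (nsum (fun n => kterm p p (inl n)))) _.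
apply: nsum_norm_le; first exact: ktermS_summable.
by move=> n; rewrite ger0_norm ?kterm_ge0.
Qed.

(** Convergence along the fixed exhaustion, with Fourier coefficients, is
    visibly linear in [f]; arbitrary linear combinations are not. *)
Definition approximable f :=
  (fun N => zdot (residual (iwin N) f) (residual (iwin N) f)) @ \oo --> (0 : R).

Lemma approximable_kron k : approximable (kron k).
Proof.
rewrite /approximable; under eq_fun do rewrite residual_kron_norm ?iwin_uniq//.
have h : (fun N => w k - w k ^+ 2 * \sum_(i <- iwin N) kterm k k i) @ \oo -->
    w k - w k ^+ 2 * span_kernel k k.
  by apply: cvgB; [exact: cvg_cst|apply: cvgMr; exact: span_kernel_cvg].
by move: h; rewrite span_kernel_diag expr2 mulfK ?subrr// gt_eqF ?weight_gt0.
Qed.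

Lemma residualD s f g k : tempered f -> tempered g ->
  residual s (fun k => f k + g k) k = residual s f k + residual s g k.
Proof.
move=> fT gT; rewrite /residual addrACA -opprD -big_split /=; congr (_ - _).
apply: eq_bigr => i _; rewrite /fcoef zdotDl//; last exact: fSM_tempered.
by ring.
Qed.

Lemma residualZ s c f k : tempered f ->
  residual s (fun k => c * f k) k = c * residual s f k.
Proof.
move=> fT; rewrite /residual mulrBr mulr_sumr; congr (_ - _).
apply: eq_bigr => i _; rewrite /fcoef zdotZl//; last exact: fSM_tempered.
by ring.
Qed.

Lemma sqrD_le (a b : R) : (a + b) ^+ 2 <= 2 * a ^+ 2 + 2 * b ^+ 2.
Proof. by have := sqr_ge0 (a - b); nra. Qed.

Lemma approximableD f g : tempered f -> tempered g ->
  approximable f -> approximable g -> approximable (fun k => f k + g k).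
Proof.
move=> fT gT fA gA.
have hc : (fun N => 2 * zdot (residual (iwin N) f) (residual (iwin N) f) +
    2 * zdot (residual (iwin N) g) (residual (iwin N) g)) @ \oo --> (0 : R).
  rewrite -[X in _ --> X]addr0 -[X in _ --> X + _](mulr0 2) -[X in _ --> _ + X](mulr0 2).
  by apply: cvgD; apply: cvgMr.
have fgT := temperedD fT gT.
apply: (squeeze_cvgr _ (cvg_cst 0) hc); apply: nearW => N.
have rf := residual_tempered (iwin N) fT; have rg := residual_tempered (iwin N) gT.
have rfg := residual_tempered (iwin N) fgT.
rewrite zdot_ge0//= -!zsumZ; [|exact: zdot_zabs|exact: zdot_zabs].
rewrite -zsumD; [|exact/zabsZ/zdot_zabs|exact/zabsZ/zdot_zabs].
apply: ler_zsum; first exact: zdot_zabs.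
  by apply: zabsD; exact/zabsZ/zdot_zabs.
move=> k; rewrite residualD//.
rewrite [leRHS](_ : _ = w k * (2 * residual (iwin N) f k ^+ 2 + 2 * residual (iwin N) g k ^+ 2)); last by ring.
by rewrite ler_wpM2l ?weight_ge0// -expr2 sqrD_le.
Qed.

Lemma approximableZ c f : tempered f -> approximable f -> approximable (fun k => c * f k).
Proof.
move=> fT fA; rewrite /approximable.
have -> : (fun N => zdot (residual (iwin N) (fun k => c * f k)) (residual (iwin N) (fun k => c * f k)))
    = (fun N => c ^+ 2 * zdot (residual (iwin N) f) (residual (iwin N) f)).
  apply/funext => N; rewrite /zdot -zsumZ; last first.
    by apply: zdot_zabs => //; exact: residual_tempered.
  by apply: eq_zsum => k; rewrite residualZ//; ring.
by rewrite -(mulr0 (c ^+ 2)); exact: cvgMr.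
Qed.

Definition cut f N k : R :=
  if (match k with Posz n | Negz n => n < N end)%N then f k else 0.

Lemma cutS f N k :
  cut f N.+1 k = cut f N k + (f N * kron N k + f (Negz N) * kron (Negz N) k).
Proof.
rewrite /cut /kron; case: k => n; rewrite ltnS leq_eqVlt.
  rewrite [Posz n == Negz N]/= mulr0 addr0 (_ : (Posz n == Posz N) = (n == N))//.
  by case: eqVneq => [->|]/=; rewrite ?ltnn ?add0r ?mulr1 ?mulr0 ?addr0.
rewrite [Negz n == Posz N]/= mulr0 add0r (_ : (Negz n == Negz N) = (n == N))//.
by case: eqVneq => [->|]/=; rewrite ?ltnn ?add0r ?mulr1 ?mulr0 ?addr0.
Qed.

Lemma cut_approximable f N : tempered (cut f N) /\ approximable (cut f N).
Proof.
elim: N => [|N [IHT IHA]].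
  have -> : cut f 0 = fun k => 0 * kron 0 k.
    by apply/funext => k; rewrite /cut mul0r; case: k.
  split; first by apply: temperedZ; exact: kron_tempered.
  by apply: approximableZ; [exact: kron_tempered|exact: approximable_kron].
rewrite (funext (cutS f N)).
have dT (c : R) k : tempered (fun j : int => c * kron k j).
  by apply: temperedZ; exact: kron_tempered.
have dA (c : R) k : approximable (fun j : int => c * kron k j).
  by apply: approximableZ; [exact: kron_tempered|exact: approximable_kron].
have T2 := temperedD (dT (f N) N) (dT (f (Negz N)) (Negz N)).
split; first exact: temperedD.
exact: (approximableD IHT T2 IHA (approximableD (dT _ _) (dT _ _) (dA _ _) (dA _ _))).
Qed.

Lemma cut_cvg f : zabs (fun k => w k * f k ^+ 2) ->
  (fun N => zsum (fun k => w k * (f k - cut f N k) ^+ 2)) @ \oo --> (0 : R).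
Proof.
move=> fz; rewrite -(@zsum0 R); apply: (zsum_tannery fz) => [N k|k].
  rewrite ger0_norm ?wsqr_ge0// ler_wpM2l ?weight_ge0//.
  by rewrite /cut; case: ifP => _; rewrite ?subr0// subrr expr0n /= sqr_ge0.
rewrite -(cvg_shiftn `|k|.+1) (_ : (fun n => _) = fun=> 0); first exact: cvg_cst.
apply/funext => n; rewrite /cut (_ : (match k with Posz n | Negz n => _ end)%N = true).
  by rewrite subrr expr0n mulr0.
by case: k => m /=; lia.
Qed.

Lemma finite_approximation f (eps : R) : 0 < eps -> zabs (fun k => w k * f k ^+ 2) ->
  exists N0, forall N, (N0 <= N)%N -> exists c : nat + int -> R,
    zabs (fun k => w k * (f k - \sum_(i <- iwin N) c i * fSM i k) ^+ 2) /\
    zsum (fun k => w k * (f k - \sum_(i <- iwin N) c i * fSM i k) ^+ 2) <= eps.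
Proof.
move=> eps0 fz; have e4 : 0 < eps / 4 by rewrite divr_gt0.
have /cvgrPdist_le/(_ _ e4)[n _ /(_ n (leqnn n))/= hn] := cut_cvg fz.
have [cT cA] := cut_approximable f n.
move/cvgrPdist_le/(_ _ e4) : cA => [N0 _ hN0].
exists N0 => N /hN0/= hN; exists (fcoef (cut f n)).
have rT := residual_tempered (iwin N) cT.
have rz : zabs (fun k => w k * residual (iwin N) (cut f n) k ^+ 2) by exact: zdot_zabs.
have tz : zabs (fun k => w k * (f k - cut f n k) ^+ 2).
  apply: (le_zabs fz) => k; rewrite !ger0_norm ?wsqr_ge0//.
  rewrite ler_wpM2l ?weight_ge0// /cut.
  by case: ifP => _; rewrite ?subr0// subrr expr0n /= sqr_ge0.
have bz := zabsD (zabsZ 2 tz) (zabsZ 2 rz).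
have le k : 0 <= w k * (f k - \sum_(i <- iwin N) fcoef (cut f n) i * fSM i k) ^+ 2 <=
    2 * (w k * (f k - cut f n k) ^+ 2) + 2 * (w k * residual (iwin N) (cut f n) k ^+ 2).
  rewrite wsqr_ge0 /=.
  rewrite [leRHS](_ : _ = w k * (2 * (f k - cut f n k) ^+ 2 + 2 * residual (iwin N) (cut f n) k ^+ 2)); last by ring.
  rewrite ler_wpM2l ?weight_ge0// (_ : f k - _ = (f k - cut f n k) + residual (iwin N) (cut f n) k).
    exact: sqrD_le.
  by rewrite /residual; ring.
have z : zabs (fun k => w k * (f k - \sum_(i <- iwin N) fcoef (cut f n) i * fSM i k) ^+ 2).
  apply: (le_zabs bz) => k; have /andP[h0 h1] := le k.
  by rewrite !ger0_norm// (le_trans h0).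
split=> //; apply: (@le_trans _ _ (2 * (eps / 4) + 2 * (eps / 4))); last by lra.
apply: le_trans (ler_zsum z bz (fun k => proj2 (andP (le k)))) _.
rewrite zsumD; [|exact: zabsZ|exact: zabsZ]; rewrite !zsumZ//.
apply: lerD; rewrite ler_pM2l//.
  by apply: le_trans (ler_norm _) _; rewrite -normrN -sub0r.
by apply: le_trans (ler_norm _) _; rewrite -normrN -sub0r.
Qed.

End Completeness.

(** * Integration against an atomic measure *)

Section Atomic.
Context d (T : measurableType d) (R : realType).
Variables (m : int -> {nonneg R}) (y : int -> T).
Local Notation mu := (atomic_measure m y).
Implicit Types (g u v : T -> R).

Definition asum g (k : int) : R := (m k)%:num * g (y k).

Lemma asum_ge0 g k : (forall p, 0 <= g p) -> 0 <= asum g k.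
Proof. by move=> g0; apply: mulr_ge0. Qed.

Lemma integral_atomic_ge0 g : measurable_fun setT g -> (forall p, 0 <= g p) ->
  (\int[mu]_p (g p)%:E = \sum_(n <oo) (asum g (Posz n))%:E +
     \sum_(n <oo) (asum g (Negz n))%:E)%E.
Proof.
move=> mg g0.
have g0' (p : T) : [set: T] p -> (0 <= (g p)%:E)%E by rewrite lee_fin.
have mgE : measurable_fun setT (EFin \o g) by exact/measurable_EFinP.
rewrite /atomic_measure ge0_integral_measure_add// !ge0_integral_measure_series//.
congr (_ + _)%E; apply: eq_eseriesr => n _;
by rewrite ge0_integral_mscale// integral_dirac// diracT mul1e EFinM.
Qed.

Lemma integral_atomic_zabs g : measurable_fun setT g -> (forall p, 0 <= g p) ->
  (\int[mu]_p (g p)%:E < +oo)%E <-> zabs (asum g).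
Proof.
move=> mg g0; rewrite integral_atomic_ge0//.
have gP n := asum_ge0 (Posz n) g0; have gN n := asum_ge0 (Negz n) g0.
have sP : (0 <= \sum_(n <oo) (asum g (Posz n))%:E)%E.
  by apply: nneseries_ge0 => n _ _; rewrite lee_fin.
have sN : (0 <= \sum_(n <oo) (asum g (Negz n))%:E)%E.
  by apply: nneseries_ge0 => n _ _; rewrite lee_fin.
split=> [h|/zabs_nabs[hP hN]].
  apply/zabs_nabs; split.
    apply/(nneseries_fin_nabs gP); apply: le_lt_trans h; exact: leeDl.
  apply/(nneseries_fin_nabs gN); apply: le_lt_trans h; exact: leeDr.
by rewrite lte_add_pinfty//; [apply/(nneseries_fin_nabs gP)|apply/(nneseries_fin_nabs gN)].
Qed.

Lemma integral_atomic_zsum g : measurable_fun setT g -> (forall p, 0 <= g p) ->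
  zabs (asum g) -> (\int[mu]_p (g p)%:E = (zsum (asum g))%:E)%E.
Proof.
move=> mg g0 /zabs_nabs[hP hN]; rewrite integral_atomic_ge0//.
by rewrite !nneseries_nabs// => n; exact: asum_ge0.
Qed.

Lemma Rintegral_atomic g : measurable_fun setT g -> zabs (asum g) ->
  (\int[mu]_p g p)%R = zsum (asum g).
Proof.
move=> mg gz; pose gp p := Num.max (g p) 0; pose gn p := Num.max (- g p) 0.
have mp : measurable_fun setT gp by apply: measurable_maxr.
have mn : measurable_fun setT gn.
  by apply: measurable_maxr => //; exact: measurableT_comp.
have p0 p : 0 <= gp p by rewrite le_max lexx orbT.
have n0 p : 0 <= gn p by rewrite le_max lexx orbT.
have gE p : g p = gp p - gn p.
  rewrite /gp /gn; case: (leP (g p) 0) => h.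
    by rewrite max_l ?oppr_ge0// sub0r opprK.
  by rewrite max_r ?subr0// oppr_le0 ltW.
have le_p p : gp p <= `|g p| by rewrite /gp ge_max ler_norm normr_ge0.
have le_n p : gn p <= `|g p| by rewrite /gn ge_max -normrN ler_norm normr_ge0.
have le h k : (forall p, 0 <= h p <= `|g p|) -> `|asum h k| <= `|asum g k|.
  move=> hg; have /andP[h0 h1] := hg (y k).
  by rewrite /asum !normrM ler_wpM2l// ger0_norm.
have zp : zabs (asum gp) by apply: (le_zabs gz) => k; apply: le => p; rewrite p0 le_p.
have zn : zabs (asum gn) by apply: (le_zabs gz) => k; apply: le => p; rewrite n0 le_n.
rewrite /Rintegral integralE.
rewrite (_ : (fun _ => _)^\+%E = fun p => (gp p)%:E); last by apply/funext => p; rewrite funeposE EFin_max.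
rewrite (_ : (fun _ => _)^\-%E = fun p => (gn p)%:E); last by apply/funext => p; rewrite funenegE EFin_max.
rewrite !integral_atomic_zsum//= -zsumB//.
by apply: eq_zsum => k; rewrite /asum -mulrBr -gE.
Qed.

Lemma Lfun2_atomic u : measurable_fun setT u -> zabs (asum (fun p => u p ^+ 2)) ->
  u \in Lfun mu 2%:E.
Proof.
move=> mfu uz; rewrite inE; apply/andP; split; rewrite inE//=.
rewrite /finite_norm unlock poweR_lty//.
have /(integral_atomic_zabs) : measurable_fun setT (fun p => u p ^+ 2) by exact: measurable_funX.
move=> /(_ (fun p => sqr_ge0 (u p)))[_ /(_ uz)]; apply: le_lt_trans.
rewrite (eq_integral (fun p => (u p ^+ 2)%:E)) ?lexx// => p _.
by rewrite /= (powR_mulrn 2)// real_normK ?num_real.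
Qed.

Lemma Lfun2_atomicP u : u \in Lfun mu 2%:E ->
  measurable_fun setT u /\ zabs (asum (fun p => u p ^+ 2)).
Proof.
move=> hu; have mfu : measurable_fun setT u.
  by move: hu; rewrite inE => /andP[/[!inE]].
split=> //; apply/integral_atomic_zabs; first exact: measurable_funX.
  by move=> p; exact: sqr_ge0.
have /integrableP[_] := Lfun2_integrable_sqr hu.
by under eq_integral => p _ do rewrite /= ger0_norm ?sqr_ge0//.
Qed.

Lemma dotL2_real u v : measurable_fun setT u -> measurable_fun setT v ->
  zabs (asum (fun p => u p * v p)) ->
  dotL2 mu (fun p => (u p)%:C) (fun p => (v p)%:C) = (zsum (asum (fun p => u p * v p)))%:C.
Proof.
move=> mfu mfv uvz; rewrite /dotL2 /cintegral.
rewrite (_ : (fun p => complex.Re _) = fun p => u p * v p); last first.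
  by apply/funext => p /=; rewrite mul0r subr0.
rewrite (_ : (fun p => complex.Im _) = fun=> 0); last first.
  by apply/funext => p /=; rewrite mul0r addr0 oppr0 mulr0.
rewrite Rintegral_atomic//; last exact: measurable_funM.
by rewrite /Rintegral integral0.
Qed.

Lemma normL2_atomic (h : T -> R[i]) :
  measurable_fun setT (fun p => complex.Re (h p)) ->
  measurable_fun setT (fun p => complex.Im (h p)) ->
  zabs (asum (fun p => complex.Re (h p) ^+ 2)) ->
  zabs (asum (fun p => complex.Im (h p) ^+ 2)) ->
  normL2 mu h = Num.sqrt (zsum (asum (fun p => complex.Re (h p) ^+ 2)) +
                          zsum (asum (fun p => complex.Im (h p) ^+ 2))).
Proof.
move=> mr mi zr zi; rewrite /normL2 /dotL2 /cintegral /=; congr Num.sqrt.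
rewrite (_ : (fun p => complex.Re _) = fun p => complex.Re (h p) ^+ 2 + complex.Im (h p) ^+ 2); last first.
  by apply/funext => p; case: (h p) => a b /=; ring.
have e k : asum (fun p => complex.Re (h p) ^+ 2) k + asum (fun p => complex.Im (h p) ^+ 2) k =
   asum (fun p => complex.Re (h p) ^+ 2 + complex.Im (h p) ^+ 2) k by rewrite /asum mulrDr.
rewrite Rintegral_atomic.
- by rewrite -zsumD//; apply: eq_zsum => k; rewrite e.
- by apply: measurable_funD; exact: measurable_funX.
- exact: eq_zabs e (zabsD zr zi).
Qed.

End Atomic.

(** * The orthogonal basis *)

Section Polynomials.
Context {R : realType} (q : R) (hq0 : 0 < q) (hq1 : q < 1).

Lemma zfact_qn n k : (k <= n)%N ->
  zfact q (q ^+ n) k * qpoch q q (n - k) = (-1) ^+ k * q ^+ 'C(k, 2) * qpoch q q n.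
Proof.
elim: k => [|k IHk] kn; first by rewrite /zfact big_ord0 subn0 !mulr1.
have := IHk (ltnW kn); rewrite zfactS binS bin1 exprD exprS mulN1r.
rewrite (_ : (n - k = (n - k.+1).+1)%N); last by lia.
rewrite qpochSr -exprS (_ : ((n - k.+1).+1 = n - k)%N); last by lia.
have -> : q ^+ n = q ^+ k * q ^+ (n - k) by rewrite -exprD subnKC// ltnW.
set Z := zfact _ _ _; set Q := qpoch q q (n - k.+1); set B := q ^+ (n - k) => h.
transitivity (- q ^+ k * (Z * (Q * (1 - B)))); first by ring.
by rewrite h; ring.
Qed.

Lemma bin2_sq k : ('C(k, 2) + 'C(k.+1, 2) = k ^ 2)%N.
Proof.
elim: k => // k IHk; rewrite [in 'C(k.+2, 2)]binS bin1 [X in (X + _)%N]binS bin1.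
by move: IHk; rewrite binS bin1 => IHk; nia.
Qed.

Lemma SW_Phi n (y : R) : SW q n y = (qpoch q q n)^-1 * Phi q (q ^+ n) y.
Proof.
rewrite /SW; congr (_ * _); rewrite /Phi (@nsum_finite _ _ n.+1).
  apply: eq_bigr => k _; have kn : (k <= n)%N by rewrite -ltnS.
  rewrite /phicoef -bin2_sq exprD.
  have h1 := qfact_neq0 hq0 hq1 k; have h2 := qfact_neq0 hq0 hq1 (n - k).
  have -> : zfact q (q ^+ n) k = (-1) ^+ k * q ^+ 'C(k, 2) * qpoch q q n / qpoch q q (n - k).
    by rewrite -zfact_qn// mulfK.
  by field; rewrite h1 h2.
move=> k nk; rewrite /phicoef (_ : zfact _ _ _ = 0) ?mul0r//.
by rewrite /zfact (bigD1 (Ordinal nk))//= subrr mul0r.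
Qed.

Lemma measurable_Phi z : measurable_fun setT (Phi q z : measurableTypeR R -> R).
Proof.
apply: (@measurable_fun_cvg _ _ _ _ (fun N y => series (phicoef q z y) N)).
  move=> N; rewrite /series /=; apply: measurable_sum => n.
  by apply: measurable_funM => //; exact: measurable_funX.
by move=> y _; apply: nsum_cvg; exact: phicoef_nabs.
Qed.

End Polynomials.

Section L2Basis.
Context {R : realType} (q t : R) (hq0 : 0 < q) (hq1 : q < 1) (ht : 0 < t).
Variables (m : int -> {nonneg R}) (hm0 : 0 < (m 0)%:num).
Local Notation x := (node q t : int -> measurableTypeR R).
Local Notation w := (weight q t).
Context (hm : forall k : int, (m k)%:num = w k * (m 0)%:num).
Local Notation mu := (atomic_measure m x).
Local Notation m0 := (m 0)%:num.
Implicit Types (i : nat + int) (k : int) (g u v : measurableTypeR R -> R).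

(** On the nodes these are multiples, with the factors [escale], of the
    eigenfunctions [fSM]. *)
Definition efun i : measurableTypeR R -> R :=
  match i with inl n => SW q n | inr r => Mfun q t r end.

Definition escale i : R :=
  match i with inl n => (qpoch q q n)^-1 | inr r => (qpoch_inf q q)^-1 end.

Definition espec i : R := match i with inl n => q ^+ n | inr r => zM q t r end.

Lemma escale_neq0 i : escale i != 0.
Proof. by case: i => [n|r]; rewrite invr_neq0 ?qfact_neq0 ?qfact_inf_neq0. Qed.

Lemma efun_Phi i y : efun i y = escale i * Phi q (espec i) y.
Proof.
case: i => [n|r] /=; first by rewrite SW_Phi.
by rewrite /Mfun phiE// (zM_neq0 hq0 ht r).
Qed.

Lemma efun_node i k : efun i (x k) = escale i * fSM q t i k.
Proof. by rewrite efun_Phi; case: i. Qed.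

Lemma measurable_efun i : measurable_fun setT (efun i).
Proof.
rewrite (_ : efun i = fun y => escale i * Phi q (espec i) y); last first.
  by apply/funext => y; exact: efun_Phi.
by apply: measurable_funM => //; exact: measurable_Phi.
Qed.

Lemma asumE g k : asum m x g k = m0 * (w k * g (x k)).
Proof. by rewrite /asum hm; ring. Qed.

Lemma zabs_asum g : zabs (asum m x g) <-> zabs (fun k => w k * g (x k)).
Proof.
split=> h; last first.
  by apply: eq_zabs (zabsZ m0 h) => k; rewrite asumE.
by apply: eq_zabs (zabsZ m0^-1 h) => k; rewrite asumE mulKf// gt_eqF.
Qed.

Lemma zsum_asum g : zabs (fun k => w k * g (x k)) ->
  zsum (asum m x g) = m0 * zsum (fun k => w k * g (x k)).
Proof. by move=> h; rewrite -zsumZ//; apply: eq_zsum => k; rewrite asumE. Qed.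

Lemma efun_pair_zabs i j : zabs (fun k => w k * (efun i (x k) * efun j (x k))).
Proof.
have h := zdot_zabs hq0 hq1 ht (fSM_tempered hq0 hq1 ht i) (fSM_tempered hq0 hq1 ht j).
by apply: eq_zabs (zabsZ (escale i * escale j) h) => k; rewrite !efun_node; ring.
Qed.

Lemma efun_pair_zsum i j :
  zsum (fun k => w k * (efun i (x k) * efun j (x k))) =
  escale i * escale j * zdot q t (fSM q t i) (fSM q t j).
Proof.
have h := zdot_zabs hq0 hq1 ht (fSM_tempered hq0 hq1 ht i) (fSM_tempered hq0 hq1 ht j).
by rewrite /zdot -zsumZ//; apply: eq_zsum => k; rewrite !efun_node; ring.
Qed.

Lemma L2_efun i : L2 mu (fun y => (efun i y)%:C).
Proof.
split; apply: Lfun2_atomic => //=.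
- exact: measurable_efun.
- by apply/zabs_asum; exact: efun_pair_zabs.
- by apply/zabs_asum; apply: eq_zabs (@zabs0 R) => k; rewrite expr0n mulr0.
Qed.

Lemma dotL2_efun i j : dotL2 mu (fun y => (efun i y)%:C) (fun y => (efun j y)%:C) =
  (m0 * (escale i * escale j * zdot q t (fSM q t i) (fSM q t j)))%:C.
Proof.
rewrite dotL2_real; do ?exact: measurable_efun.
  by rewrite zsum_asum ?efun_pair_zsum//; exact: efun_pair_zabs.
by apply/zabs_asum; exact: efun_pair_zabs.
Qed.

Lemma dotL2_efun_orth i j : i <> j ->
  dotL2 mu (fun y => (efun i y)%:C) (fun y => (efun j y)%:C) = 0.
Proof. by move=> /eqP ij; rewrite dotL2_efun fSM_orthogonal// !mulr0. Qed.

Lemma normL2_efun_neq0 i : normL2 mu (fun y => (efun i y)%:C) <> 0.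
Proof.
rewrite /normL2 dotL2_efun /=; apply/eqP; rewrite gt_eqF// sqrtr_gt0.
rewrite mulr_gt0// mulr_gt0//; last exact: (sqnorm_gt0 hq0 hq1 ht i).
by rewrite -expr2 lt_def sqr_ge0 expf_neq0// escale_neq0.
Qed.

Lemma Re_sum_efun (c : nat + int -> R[i]) s y :
  complex.Re (\sum_(i <- s) c i * (efun i y)%:C) = \sum_(i <- s) complex.Re (c i) * efun i y.
Proof.
elim: s => [|i s IHs]; first by rewrite !big_nil.
rewrite !big_cons -IHs; case: (\sum_(_ <- _) _) => a b; case: (c i) => a' b' /=.
by rewrite mulr0 subr0.
Qed.

Lemma Im_sum_efun (c : nat + int -> R[i]) s y :
  complex.Im (\sum_(i <- s) c i * (efun i y)%:C) = \sum_(i <- s) complex.Im (c i) * efun i y.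
Proof.
elim: s => [|i s IHs]; first by rewrite !big_nil.
rewrite !big_cons -IHs; case: (\sum_(_ <- _) _) => a b; case: (c i) => a' b' /=.
by rewrite mulr0 add0r.
Qed.

Lemma measurable_remainder u s (c : nat + int -> R) : measurable_fun setT u ->
  measurable_fun setT (fun y => u y - \sum_(i <- s) c i * efun i y).
Proof.
move=> mfu; apply: measurable_funB => //; apply: measurable_sum => i.
by apply: measurable_funM => //; exact: measurable_efun.
Qed.

(** The eigenfunctions are real, so real and imaginary parts are approximated
    separately, on a common finite index set. *)
Lemma efun_dense (f : measurableTypeR R -> R[i]) : L2 mu f -> forall eps : R, 0 < eps ->
  exists (s : seq (nat + int)) (c : nat + int -> R[i]),
    normL2 mu (fun y => f y - \sum_(i <- s) c i * (efun i y)%:C) < eps.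
Proof.
move=> [/Lfun2_atomicP[mr zr] /Lfun2_atomicP[mi zi]] eps eps0.
pose e := eps ^+ 2 / 4 / m0.
have e0 : 0 < e by rewrite !divr_gt0// exprn_gt0.
have [N1 h1] := finite_approximation hq0 hq1 ht e0 ((zabs_asum (fun y => complex.Re (f y) ^+ 2)).1 zr).
have [N2 h2] := finite_approximation hq0 hq1 ht e0 ((zabs_asum (fun y => complex.Im (f y) ^+ 2)).1 zi).
have [cr [zcr scr]] := h1 _ (leq_maxl N1 N2).
have [ci [zci sci]] := h2 _ (leq_maxr N1 N2).
set s := iwin _ in zcr scr zci sci.
exists s, (fun i => (cr i / escale i) +i* (ci i / escale i)).
pose fr y := complex.Re (f y) - \sum_(i <- s) (cr i / escale i) * efun i y.
pose fi y := complex.Im (f y) - \sum_(i <- s) (ci i / escale i) * efun i y.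
set h := (fun y => _ - _).
have hr : (fun y => complex.Re (h y)) = fr.
  apply/funext => y; rewrite /h /fr -[in RHS](Re_sum_efun (fun i => (cr i / escale i) +i* (ci i / escale i))).
  by case: (f y) => a b; case: (\sum_(_ <- _) _).
have hi : (fun y => complex.Im (h y)) = fi.
  apply/funext => y; rewrite /h /fi -[in RHS](Im_sum_efun (fun i => (cr i / escale i) +i* (ci i / escale i))).
  by case: (f y) => a b; case: (\sum_(_ <- _) _).
have nodeE (c : nat + int -> R) k :
    \sum_(i <- s) (c i / escale i) * efun i (x k) = \sum_(i <- s) c i * fSM q t i k.
  by apply: eq_bigr => i _; rewrite efun_node mulrA divfK ?escale_neq0.
have ar k : w k * (complex.Re (f (x k)) - \sum_(i <- s) cr i * fSM q t i k) ^+ 2 = w k * fr (x k) ^+ 2.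
  by rewrite /fr nodeE.
have ai k : w k * (complex.Im (f (x k)) - \sum_(i <- s) ci i * fSM q t i k) ^+ 2 = w k * fi (x k) ^+ 2.
  by rewrite /fi nodeE.
have zr' := eq_zabs ar zcr; have zi' := eq_zabs ai zci.
rewrite (eq_zsum ar) in scr; rewrite (eq_zsum ai) in sci.
have hr2 : (fun y => complex.Re (h y) ^+ 2) = (fun y => fr y ^+ 2).
  by apply/funext => y; rewrite -[complex.Re (h y)]/((fun y => complex.Re (h y)) y) hr.
have hi2 : (fun y => complex.Im (h y) ^+ 2) = (fun y => fi y ^+ 2).
  by apply/funext => y; rewrite -[complex.Im (h y)]/((fun y => complex.Im (h y)) y) hi.
rewrite normL2_atomic ?hr ?hi ?hr2 ?hi2.
- rewrite (@zsum_asum (fun y => fr y ^+ 2))// (@zsum_asum (fun y => fi y ^+ 2))//.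
  rewrite -[ltRHS](ger0_norm (ltW eps0)) -sqrtr_sqr ltr_sqrt ?exprn_gt0//.
  apply: (@le_lt_trans _ _ (m0 * e + m0 * e)); first by rewrite lerD// ler_wpM2l// ltW.
  rewrite (_ : m0 * e = eps ^+ 2 / 4); last by rewrite /e mulrC divfK// gt_eqF.
  by have := exprn_gt0 2 eps0; lra.
- exact: measurable_remainder.
- exact: measurable_remainder.
- exact/zabs_asum.
- exact/zabs_asum.
Qed.

End L2Basis.

Theorem theorem3p5 (R : realType) (q t : R) (hq0 : 0 < q) (hq1 : q < 1)
    (ht : 0 < t) (m : int -> {nonneg R}) (hm0 : 0 < (m 0)%:num)
    (hm : forall k : int, (m k)%:num = t ^ k * q ^ binz k * (m 0)%:num) :
  let x : int -> measurableTypeR R := fun k => t * q ^ k in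
  let w : int -> R := fun k => t ^ k * q ^ binz k in
  let mu : {measure set (measurableTypeR R) -> \bar R} := atomic_measure m x in
  let S : nat -> measurableTypeR R -> R[i] := fun n y => (SW q n y)%:C in
  let M : int -> measurableTypeR R -> R[i] := fun r y => (Mfun q t r y)%:C in
  [/\ orthogonal_family mu S /\ orthogonal_family mu M,
      forall n n' : nat,
        zsummable (fun k => w k * SW q n (x k) * SW q n' (x k)) /\
        (qpoch_inf (- t * q) q * qpoch_inf (- t^-1) q * qpoch_inf q q)^-1 *
          zsum (fun k => w k * SW q n (x k) * SW q n' (x k))
        = (n == n')%:R / (q ^+ n * qpoch q q n),
      forall r s : int,
        zsummable (fun k => w k * Mfun q t r (x k) * Mfun q t s (x k)) /\
        (qpoch_inf (- t) q)^-1 *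
          zsum (fun k => w k * Mfun q t r (x k) * Mfun q t s (x k))
        = qpochz (- (q / t)) q r / q ^ r * (r == s)%:R,
      (forall (n : nat) (r : int),
        zsummable (fun k => w k * SW q n (x k) * Mfun q t r (x k)) /\
        zsum (fun k => w k * SW q n (x k) * Mfun q t r (x k)) = 0) /\
      (forall (n : nat) (r : int), dotL2 mu (S n) (M r) = 0) &
      orthogonal_basis mu
        (fun i : nat + int => match i with inl n => S n | inr r => M r end)].
Proof.
move=> x w mu S M.
have hm' k : (m k)%:num = weight q t k * (m 0)%:num := hm k.
have pz := efun_pair_zabs hq0 hq1 ht; have ps := efun_pair_zsum hq0 hq1 ht.
have sm i j : zsummable (fun k => w k * efun q t i (x k) * efun q t j (x k)).
  by apply: zabs_zsummable; apply: eq_zabs (pz i j) => k; rewrite mulrA.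
have sv i j : zsum (fun k => w k * efun q t i (x k) * efun q t j (x k)) =
    escale q i * escale q j * zdot q t (fSM q t i) (fSM q t j).
  by rewrite -ps; apply: eq_zsum => k; rewrite mulrA.
have th0 := Theta_gt0 hq0 hq1 ht.
split.
- split; split.
  + by move=> n; exact: (L2_efun hq0 hq1 ht hm0 hm' (inl n)).
  + move=> n n' nn'.
    by apply: (dotL2_efun_orth hq0 hq1 ht hm0 hm' (i := inl n) (j := inl n')) => -[].
  + by move=> r; exact: (L2_efun hq0 hq1 ht hm0 hm' (inr r)).
  + move=> r s rs.
    by apply: (dotL2_efun_orth hq0 hq1 ht hm0 hm' (i := inr r) (j := inr s)) => -[].
- move=> n n'; split; first exact: (sm (inl n) (inl n')).
  rewrite (sv (inl n) (inl n')) -triple_product//=.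
  have [<-|nn'] := eqVneq n n'; last by rewrite fS_orth// !mulr0 mul0r.
  rewrite fS_norm// -[true%:R]/(1 : R); field.
  by rewrite expf_neq0 ?gt_eqF// qfact_gt0.
- move=> r s; split; first exact: (sm (inr r) (inr s)).
  rewrite (sv (inr r) (inr s))/=.
  have [<-|rs] := eqVneq r s; last by rewrite fM_orth// !mulr0.
  rewrite fM_norm// -[true%:R]/(1 : R); field.
  rewrite expfz_neq0 ?gt_eqF ?qfact_inf_gt0//.
  by rewrite (lt_le_trans ltr01)// qpoch_inf_ge1// oppr_le0 ltW.
- split=> n r; first split.
  + exact: (sm (inl n) (inr r)).
  + by rewrite (sv (inl n) (inr r)) fSM_orth// mulr0.
  + exact: (dotL2_efun_orth hq0 hq1 ht hm0 hm' (i := inl n) (j := inr r)).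
- have eE : (fun i : nat + int => match i with inl n => S n | inr r => M r end) =
      (fun i y => (efun q t i y)%:C) by apply/funext => -[].
  rewrite eE; split.
  + split=> [i|i j]; first exact: L2_efun.
    exact: dotL2_efun_orth.
  + exact: normL2_efun_neq0.
  + exact: efun_dense.
Qed.
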